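(* There are, up to equivalence, exactly $15$ different $(20,8)$-codes of size $256$ with all distances divisible by $4$.
   Context: Let $\mathbb{F}_2=\{0,1\}$ be the field of two elements. The (Hamming) distance $d_H(u,v)$ of words $u,v\in\mathbb{F}_2^n$ is the number of $i$ with $u_i\neq v_i$. An $(n,d)$-code is a subset $C\subseteq\mathbb{F}_2^n$ (not necessarily linear) such that $d_H(u,v)\geq d$ for all distinct $u,v\in C$. ''All distances divisible by $4$'' means that $4\mid d_H(u,v)$ for all $u,v\in C$. Two binary codes $C,D\subseteq\mathbb{F}_2^n$ are equivalent if $D$ can be obtained from $C$ by first permuting the $n$ coordinates and subsequently permuting the alphabet $\{0,1\}$ in each coordinate separately. *)

(* Defs.v *)
From HB Require Import structures.
From mathcomp Require Import all_boot all_order all_fingroup all_algebra.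

Set Implicit Arguments.
Unset Strict Implicit.
Unset Printing Implicit Defensive.

Import GRing.Theory.

Section Codes.

Variable n : nat.

Implicit Types (u v : 'rV['F_2]_n) (C D : {set 'rV['F_2]_n}).

Definition hamming_dist u v : nat :=
  #|[set i : 'I_n | u ord0 i != v ord0 i]|.

Definition is_code (d : nat) C : bool :=
  [forall u in C, forall v in C, (u != v) ==> (d <= hamming_dist u v)].

Definition dists_divisible (k : nat) C : bool :=
  [forall u in C, forall v in C, k %| hamming_dist u v].

(* The coordinates are permuted first; then the alphabet at position i is
   permuted by p i. *)
Definition word_map (s : 'S_n) (p : {ffun 'I_n -> {perm 'F_2}}) u :
    'rV['F_2]_n :=
  \row_i p i (u ord0 (s i)).

Definition code_equiv C D : bool :=
  [exists s : 'S_n, exists p : {ffun 'I_n -> {perm 'F_2}},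
     D == [set word_map s p u | u in C]].

Lemma code_equivP C D :
  reflect (exists s p, D = [set word_map s p u | u in C]) (code_equiv C D).
Proof.
apply: (iffP existsP) => [[s /existsP[p /eqP->]]|[s [p ->]]]; exists s.
  by exists p.
by apply/existsP; exists p.
Qed.

Lemma code_equiv_refl C : code_equiv C C.
Proof.
apply/code_equivP; exists 1%g, [ffun=> 1%g].
rewrite -[LHS]imset_id; apply: eq_imset => u.
by apply/rowP=> i; rewrite mxE ffunE !perm1.
Qed.

Lemma code_equiv_sym C D : code_equiv C D -> code_equiv D C.
Proof.
case/code_equivP=> s [p ->]; apply/code_equivP.
exists s^-1%g, [ffun i => (p (s^-1%g i))^-1%g].
rewrite -imset_comp -[LHS]imset_id; apply: eq_imset => u /=.
by apply/rowP=> i; rewrite !mxE ffunE permK permKV.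
Qed.

Lemma code_equiv_trans C D E :
  code_equiv C D -> code_equiv D E -> code_equiv C E.
Proof.
case/code_equivP=> s [p ->] /code_equivP[t [q ->]]; apply/code_equivP.
exists (t * s)%g, [ffun i => (p (t i) * q i)%g].
rewrite -imset_comp; apply: eq_imset => u /=.
by apply/rowP=> i; rewrite !mxE ffunE !permM.
Qed.

(* Hence equivalence_partition code_equiv is a genuine partition into classes. *)
Lemma code_equiv_equivalence : equivalence_rel code_equiv.
Proof.
move=> C D E; split=> [|CD]; first exact: code_equiv_refl.
by apply/idP/idP; apply: code_equiv_trans => //; apply: code_equiv_sym.
Qed.

End Codes.

(* Main.v *)
From HB Require Import structures.
Require Import Defs.
From Stdlib Require Import BinNat Nnat MSetPositive.
From mathcomp Require Import all_boot all_order all_fingroup all_algebra.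
From mathcomp Require Import zify.

Set Implicit Arguments.
Unset Strict Implicit.
Unset Printing Implicit Defensive.

Import Order.TTheory GRing.Theory Num.Theory FinRing.Theory.

(** The codes [C] are classified as follows.

    Assume that [C] contains the zero word, and let [D] be the linear span of
    [C] and the all-one word.  All inner products and all weights in [D] are
    divisible by [2] and by [4] respectively.  A Gauss sum shows that such a
    [D] of length 20 is not self-dual, so its dimension is 8 or 9
    ([hull_card_exp]).  The second moment of the weight distribution gives
    [4 |D| <= 256 a + 768], where [a] counts the words of weight 4
    ([hull_second_moment]).  Dimension 8 would make [C = D] contain a word of
    weight 4, which is impossible; so [D] has dimension 9 and [a] is at least 5.
    As [C] is half of [D] and has minimum distance 8, adding a word of weight 4
    exchanges [C] with its complement in [D] ([tetrad_flip]); hence these words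
    have pairwise disjoint supports, and five of them, the tetrads, partition
    the coordinates into blocks of size 4.

    On each block, modulo its tetrad, a word of [D] takes one of four values,
    which form a vector space of dimension 2 over the field with two elements.
    A word of [D] that is nonzero modulo the tetrads vanishes on exactly one
    block ([two_blocks]), so that [D] modulo the tetrads is an additive code of
    length 5, size 16 and minimum distance 4 over the field [F_4].  Such a code
    is unique: up to a permutation of the coordinates, it is the set of all
    [(x, y, x + y, x + w y, x + w^2 y)], where [w] generates the multiplicative
    group of [F_4] ([hexacode_frame], [basis_standard]).  So [D] is a fixed
    standard code, and [C] consists of the words of [D] in which the parity of
    the number of tetrads is prescribed by a boolean function [f] of the 16
    classes [(x, y)] modulo the tetrads ([good_equiv_stdcode]).

    It remains to count the functions [f] up to symmetry.  Double
    transpositions inside blocks and translations by tetrads add any affine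
    function to [f] ([affine_equiv]), which leaves 2^11 functions; translations
    and elements of [GL_2(F_4)] connect each of these to one of the 15
    functions of the list [reps] ([good_reached]).  Finally, for a code [C],
    count the triples [x, y, w] of words of [D] such that an odd number of
    [x], [y], [w], [x + y + w] lie in [C], and count those among them that are
    collinear as points of the affine plane over [F_4].  Both numbers can be
    defined from Hamming distances, so they are invariant under equivalence
    ([triple_count_equiv]), and they distinguish the 15 functions
    ([triple_counts_uniq]). *)

(** * Binary words, weights and characters *)

Section Words.

Local Open Scope ring_scope.

Variable n : nat.

Implicit Types (u v w : 'rV['F_2]_n) (D : {group 'rV['F_2]_n}).

Lemma F2_cases (x : 'F_2) : x = 0 \/ x = 1.
Proof. by case: x => [[|[|//]] ?]; [left | right]; apply: val_inj. Qed.

Lemma F2_neq0 (x : 'F_2) : (x != 0) = (x == 1).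
Proof. by case: (F2_cases x) => ->. Qed.

Lemma addFF2 (x : 'F_2) : x + x = 0.
Proof. by case: (F2_cases x) => ->; apply: val_inj. Qed.

Lemma addF2_eq0 (x y : 'F_2) : (x + y == 0) = (x == y).
Proof. by case: (F2_cases x) => ->; case: (F2_cases y) => ->. Qed.

Lemma addWW u : u + u = 0.
Proof. by apply/rowP=> i; rewrite !mxE addFF2. Qed.

Lemma oppW u : - u = u.
Proof. by apply/eqP; rewrite eq_sym -addr_eq0 addWW. Qed.

Lemma addWK u v : u + v + v = u.
Proof. by rewrite -addrA addWW addr0. Qed.

Lemma addKW u v : u + (u + v) = v.
Proof. by rewrite addrA addWW add0r. Qed.

Lemma addWI v : injective (fun u => u + v).
Proof. exact: addIr. Qed.

(** The support and the Hamming weight of a word. *)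
Definition supp u : {set 'I_n} := [set i | u 0 i != 0].

Definition wt u : nat := #|supp u|.

Lemma hamming_distE u v : hamming_dist u v = wt (u + v).
Proof.
rewrite /hamming_dist /wt; congr #|pred_of_set _|; apply/setP=> i.
by rewrite !inE mxE; case: (F2_cases (u ord0 i)) => ->;
   case: (F2_cases (v ord0 i)) => ->.
Qed.

Lemma wt0 : wt 0 = 0%N.
Proof. by apply/eqP; rewrite cards_eq0; apply/eqP/setP=> i; rewrite !inE mxE eqxx. Qed.

Lemma wt_eq0 u : (wt u == 0%N) = (u == 0).
Proof.
apply/idP/eqP=> [|->]; last by rewrite wt0.
rewrite cards_eq0 => /eqP/setP su; apply/rowP=> i; rewrite mxE.
by move: (su i); rewrite !inE => /negbFE/eqP.
Qed.

Lemma supp_add u v : supp (u + v) = (supp u :\: supp v) :|: (supp v :\: supp u).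
Proof.
apply/setP=> i; rewrite !inE mxE.
by case: (F2_cases (u 0 i)) => ->; case: (F2_cases (v 0 i)) => ->.
Qed.

Lemma wt_add u v : (wt (u + v) + 2 * #|supp u :&: supp v| = wt u + wt v)%N.
Proof.
rewrite /wt supp_add cardsU.
have -> : (supp u :\: supp v) :&: (supp v :\: supp u) = set0.
  by apply/setP=> i; rewrite !inE; case: (u 0 i != 0); case: (v 0 i != 0).
rewrite cards0 subn0 -(cardsID (supp v) (supp u)) -(cardsID (supp u) (supp v)).
by rewrite [supp v :&: supp u]setIC; lia.
Qed.

(** The word all of whose entries are [1]. *)
Definition allone : 'rV['F_2]_n := const_mx 1.

Lemma wt_allone : wt allone = n.
Proof.
rewrite /wt -[RHS]card_ord -cardsT; congr #|pred_of_set _|.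
by apply/setP=> i; rewrite !inE mxE.
Qed.

Lemma wt_addallone u : wt (u + allone) = (n - wt u)%N.
Proof.
have := wt_add u allone; rewrite wt_allone.
have -> : supp u :&: supp allone = supp u.
  by apply/setP=> i; rewrite !inE mxE andbT.
by rewrite -/(wt u); lia.
Qed.

(** The standard inner product. *)
Definition ip u v : 'F_2 := \sum_i u 0 i * v 0 i.

Lemma ipC u v : ip u v = ip v u.
Proof. by apply: eq_bigr => i _; rewrite mulrC. Qed.

Lemma ipDr u v w : ip u (v + w) = ip u v + ip u w.
Proof. by rewrite -big_split; apply: eq_bigr => i _; rewrite mxE mulrDr. Qed.

Lemma ip0r u : ip u 0 = 0.
Proof. by apply: big1 => i _; rewrite mxE mulr0. Qed.

Lemma ip_delta u i : ip u (delta_mx 0 i) = u 0 i.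
Proof.
rewrite /ip (bigD1 i) //= mxE !eqxx mulr1 big1 ?addr0 // => j ji.
by rewrite mxE (negbTE ji) andbF mulr0.
Qed.

Lemma ip_card u v : ip u v = #|supp u :&: supp v|%:R.
Proof.
rewrite -sum1_card natr_sum [RHS]big_mkcond; apply: eq_bigr => i _.
rewrite !inE; case: (F2_cases (u 0 i)) => ->; case: (F2_cases (v 0 i)) => ->;
  by apply: val_inj.
Qed.

Lemma natF2_eq0 k : ((k%:R : 'F_2) == 0) = ~~ odd k.
Proof. by rewrite -(@dvdn_pcharf _ 2) ?dvdn2 // pchar_Fp. Qed.

Lemma ip_eq0 u v : (ip u v == 0) = ~~ odd #|supp u :&: supp v|.
Proof. by rewrite ip_card natF2_eq0. Qed.

(** The dual code of a linear code [D]. *)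
Definition dual D := [set v | [forall d in D, ip v d == 0]].

Lemma dualP D v : reflect {in D, forall d, ip v d = 0} (v \in dual D).
Proof.
rewrite inE; apply: (iffP forall_inP) => h d /h; first by move/eqP.
by move=> ->.
Qed.

Lemma dual_group_set D : group_set (dual D).
Proof.
apply/group_setP; split=> [|u v /dualP hu /dualP hv]; apply/dualP=> d dD.
  by rewrite zmod1gE ipC ip0r.
by rewrite zmodMgE ipC ipDr !(ipC d) hu // hv // addr0.
Qed.
Canonical dual_group D := Group (dual_group_set D).

Section Characters.

Variable R : idomainType.
Hypothesis two_neq0 : (2%:R : R) != 0.

(** The nontrivial character of the field with two elements. *)
Definition chi (x : 'F_2) : R := (-1) ^+ x.

Lemma chiD : {morph chi : x y / x + y >-> x * y}.
Proof.
move=> x y; case: (F2_cases x) => ->; case: (F2_cases y) => ->;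
  by rewrite /chi /= ?expr0 ?expr1 ?mulr1 ?mul1r ?mulrNN ?mulr1.
Qed.

Lemma chi_nat k : chi k%:R = (-1) ^+ k.
Proof. by elim: k => [|k IH] //; rewrite -natr1 chiD IH exprSr. Qed.

Lemma sum_chi D v :
  \sum_(d in D) chi (ip v d) = if v \in dual D then #|D|%:R else 0.
Proof.
case: ifP => [/dualP h|/negP nv].
  by rewrite (eq_bigr (fun=> 1)) ?sumr_const // => d /h ->.
have [d0 d0D nz] : exists2 d, d \in D & ip v d != 0.
  apply/exists_inP; apply: contra_notT nv => /exists_inPn h.
  by apply/dualP => d /h; rewrite negbK => /eqP.
set S := \sum_(d in D) _.
have SN : S = - S.
  rewrite /S {1}(reindex_inj (addIr d0)) -sumrN; apply: eq_big => [d|d _].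
    by rewrite -(groupMr d d0D) zmodMgE.
  rewrite ipDr chiD; move: nz; rewrite F2_neq0 => /eqP ->.
  by rewrite /chi expr1 mulrN1.
apply/eqP; have /eqP : 2%:R * S = 0 by rewrite mulr_natl mulr2n {2}SN subrr.
by rewrite mulf_eq0 (negbTE two_neq0).
Qed.

End Characters.

Lemma dual_setT : dual [set: _]%G = [set 0].
Proof.
apply/setP=> v; rewrite [RHS]inE; apply/dualP/eqP=> [h|-> d _].
  by apply/rowP=> i; rewrite -ip_delta h ?inE // mxE.
by rewrite ipC ip0r.
Qed.

Lemma card_dual D : (#|D| * #|dual D| = 2 ^ n)%N.
Proof.
have t0 : (2%:R : int) != 0 by [].
apply/eqP; rewrite -(eqr_nat int) natrM.
rewrite [X in X == _](_ : _ = \sum_v \sum_(d in D) chi int (ip v d)); last first.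
  rewrite (eq_bigr _ (fun v _ => sum_chi t0 D v)) -big_mkcond /=.
  by rewrite sumr_const mulr_natr.
rewrite exchange_big /=.
have E d : \sum_v chi int (ip v d) = if d == 0 then (2 ^ n)%:R else 0.
  have := sum_chi t0 [set: 'rV['F_2]_n]%G d; rewrite dual_setT inE cardsT.
  rewrite card_mx card_Fp // mul1n => <-.
  by apply: eq_big => v; rewrite ?inE // ipC.
rewrite (eq_bigr _ (fun d _ => E d)) -big_mkcondr /= (big_pred1 0) // => d.
by rewrite /= andbC; case: eqP => // ->; rewrite -zmod1gE group1.
Qed.

Lemma wt_prod (R : comPzRingType) (a : R) u :
  a ^+ wt u = \prod_i (if u 0 i != 0 then a else 1).
Proof.
rewrite -big_mkcond /= -(eq_bigl _ _ (fun i => in_set (fun i => u 0 i != 0) i)).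
by rewrite prodr_const.
Qed.

Lemma sum_exp_wt (R : comPzRingType) (a : R) :
  \sum_(u : 'rV['F_2]_n) a ^+ wt u = (1 + a) ^+ n.
Proof.
rewrite (reindex (fun f : {ffun 'I_n -> 'F_2} => \row_i f i)) /=; last first.
  exists (fun u : 'rV_n => [ffun i => u 0 i]) => [f _|u _].
    by apply/ffunP=> i; rewrite ffunE mxE.
  by apply/rowP=> i; rewrite mxE ffunE.
under eq_bigr => f _.
  rewrite wt_prod; under eq_bigr => i _ do rewrite mxE.
  over.
rewrite -(bigA_distr_bigA (fun (_ : 'I_n) (x : 'F_2) => if x != 0 then a else 1)).
rewrite (eq_bigr (fun=> 1 + a)) ?prodr_const ?card_ord // => i _.
rewrite (bigD1 0) //= (bigD1 1) //= big1 ?addr0 // => x.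
by case: (F2_cases x) => ->.
Qed.

(** The sum of [i ^ (wt u)] over all words [u] is computed in two ways, as a
    product over the coordinates and by cosets of [D].  The square root [i] of
    [-1] is taken to be [2] in the field with five elements. *)
Lemma gauss_sum D : dual D = D -> {in D, forall d, (4 %| wt d)%N} ->
  (3%:R : 'F_5) ^+ n = #|D|%:R.
Proof.
move=> sd de; have t0 : (2%:R : 'F_5) != 0 by [].
have i4 : (2%:R : 'F_5) ^+ 4 = 1 by apply: val_inj.
have i2 : (2%:R : 'F_5) ^+ 2 = -1 by apply: val_inj.
have shift d v : d \in D ->
    (2%:R : 'F_5) ^+ wt (v + d) = 2%:R ^+ wt v * chi _ (ip v d).
  move=> /de /dvdnP[k dk]; have := wt_add v d; rewrite dk => E.
  have : (2%:R : 'F_5) ^+ wt (v + d) * chi _ (ip v d) = 2%:R ^+ wt v.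
    rewrite ip_card chi_nat -i2 -exprM -exprD E exprD mulnC exprM i4.
    by rewrite expr1n mulr1.
  move=> <-; rewrite -mulrA -chiD addFF2 /chi expr0 mulr1 //.
have : \sum_(d in D) \sum_v (2%:R : 'F_5) ^+ wt (v + d) = #|D|%:R * #|D|%:R.
  rewrite exchange_big /=.
  under eq_bigr => v _.
    rewrite (eq_bigr _ (fun d dD => shift d v dD)) -mulr_sumr sum_chi // sd.
    over.
  rewrite (bigID (mem D)) /= [X in _ + X]big1 ?addr0; last first.
    by move=> v /negbTE->; rewrite mulr0.
  rewrite (eq_bigr (fun=> #|D|%:R)) ?sumr_const ?mulr_natl // => v vD.
  rewrite vD; case/dvdnP: (de _ vD) => k ->.
  by rewrite mulnC exprM i4 expr1n mul1r.
under eq_bigr => d _.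
  have <- := reindex_inj (addIr d) (P := xpredT)
               (F := fun v => (2%:R : 'F_5) ^+ wt v).
  rewrite sum_exp_wt.
  over.
rewrite sumr_const -[_ *+ _]mulr_natl => E.
rewrite -[3%:R]/(1 + 2%:R); apply: mulfI E.
have : (#|D| %| 2 ^ n)%N by rewrite -(card_dual D) dvdn_mulr.
by case/dvdn_pfactor=> // k _ ->; rewrite natrX expf_neq0.
Qed.

(** Only the diagonal terms are kept in the expansion of the second moment as
    a sum over pairs of coordinates; the other terms are nonnegative. *)
Lemma sum_sqr_wt D :
  \sum_(d in D) (n%:R - 2%:R * (wt d)%:R : int) ^+ 2 >= (n * #|D|)%:R.
Proof.
have t0 : (2%:R : int) != 0 by [].
have E d : (n%:R - 2%:R * (wt d)%:R : int) = \sum_i chi _ (d 0 i).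
  have chiE (x : 'F_2) : chi int x = 1 - (2 * (x != 0)%:R).
    by case: (F2_cases x) => ->.
  rewrite (eq_bigr _ (fun i _ => chiE (d 0 i))) sumrB -mulr_sumr -natr_sum.
  rewrite sumr_const card_ord; congr (_ - 2 * _%:R).
  rewrite /wt -sum1_card big_mkcond; apply: eq_bigr => i _.
  by rewrite inE; case: (_ != _).
have -> : \sum_(d in D) (n%:R - 2%:R * (wt d)%:R : int) ^+ 2 =
   \sum_i \sum_j \sum_(d in D) chi int (ip (delta_mx 0 i + delta_mx 0 j) d).
  under [RHS]eq_bigr => i _ do rewrite exchange_big /=.
  rewrite exchange_big /=; apply: eq_bigr => d _.
  rewrite E expr2 mulr_suml; apply: eq_bigr => i _.
  rewrite mulr_sumr; apply: eq_bigr => j _.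
  by rewrite ipC ipDr !ip_delta chiD.
have -> : ((n * #|D|)%:R : int) = \sum_(i < n) #|D|%:R.
  by rewrite sumr_const card_ord natrM mulr_natl.
apply: ler_sum => i _; rewrite (bigD1 i) //= sum_chi //.
rewrite ifT; last by apply/dualP=> d _; rewrite addWW ipC ip0r.
rewrite lerDl; apply: sumr_ge0 => j _; rewrite sum_chi //.
by case: ifP => // _; rewrite ler0n.
Qed.

End Words.

(** * The linear hull and its words of weight four *)

Section Hull.

Local Open Scope ring_scope.

Notation W := 'rV['F_2]_20.

Implicit Types (C : {set W}) (u v x s : W).

(** The codes to be classified. *)
Definition good C :=
  [&& is_code 8 C, #|C| == 256%N & dists_divisible 4 C].

Lemma mem_dual_gen (A : {set W}) v :
  {in A, forall a, ip v a = 0} -> v \in dual <<A>>%G.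
Proof.
move=> h; pose K := [set x : W | ip v x == 0].
have gK : group_set K.
  apply/group_setP; split=> [|x y]; first by rewrite inE zmod1gE ip0r.
  by rewrite !inE zmodMgE ipDr => /eqP-> /eqP->; rewrite addr0.
apply/dualP=> d; suff /subsetP h' : <<A>>%g \subset Group gK.
  by move/h'; rewrite inE => /eqP.
by rewrite gen_subG; apply/subsetP=> a /h e; rewrite inE e.
Qed.

(** The linear code spanned by [C] and the all-one word; linear codes are
    encoded as subgroups of the additive group of words. *)
Definition hull C : {group W} := <<allone 20 |: C>>%G.

(** The words of weight 4 of the hull. *)
Definition tetrads C := [set s in hull C | wt s == 4%N].

Variable C : {set W}.
Hypotheses (gC : good C) (C0 : 0 \in C).

Let D := hull C.
Let S := tetrads C.

Lemma sub_hull : C \subset D.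
Proof. by apply: subset_trans (subset_gen _); apply: subsetUr. Qed.

Lemma hull_allone : allone 20 \in D.
Proof. by apply: mem_gen; rewrite !inE eqxx. Qed.

Lemma hull0 : 0 \in D. Proof. exact: group1. Qed.

Lemma hullD x y : x \in D -> y \in D -> x + y \in D.
Proof. exact: groupM. Qed.

Lemma hullDr x y : y \in D -> (x + y \in D) = (x \in D).
Proof. by move=> yD; rewrite -zmodMgE groupMr. Qed.

Lemma code_wt4 : {in C &, forall u v, (4 %| wt (u + v))%N}.
Proof.
case/and3P: gC => _ _ /forall_inP h u v /h /forall_inP hu /hu.
by rewrite hamming_distE.
Qed.

Lemma code_wt8 : {in C &, forall u v, u != v -> (8 <= wt (u + v))%N}.
Proof.
case/and3P: gC => /forall_inP h _ _ u v /h /forall_inP hu /hu /implyP uv ne.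
by rewrite -hamming_distE uv.
Qed.

Let gens := allone 20 |: C.

Lemma gens_wt4 : {in gens &, forall u v, (4 %| wt (u + v))%N}.
Proof.
have h u : u \in C -> (4 %| wt (u + allone 20))%N.
  move=> uC; have := code_wt4 uC C0; rewrite addr0 => /dvdnP[k].
  by rewrite wt_addallone => ->; lia.
move=> u v /setU1P[->|uC] /setU1P[->|vC]; first by rewrite addWW wt0.
- by rewrite addrC h.
- exact: h.
exact: code_wt4.
Qed.

Lemma gens_ip : {in gens &, forall u v, ip u v = 0}.
Proof.
have g0 : 0 \in gens by rewrite inE C0 orbT.
move=> u v ug vg; apply/eqP; rewrite ip_eq0.
have := wt_add u v; have /dvdnP[k ->] := gens_wt4 ug vg.
have /dvdnP[l] := gens_wt4 ug g0; rewrite addr0 => ->.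
have /dvdnP[m] := gens_wt4 vg g0; rewrite addr0 => ->.
lia.
Qed.

Lemma hull_sub_dual : D \subset dual D.
Proof.
rewrite gen_subG; apply/subsetP=> u ug; apply: mem_dual_gen => v vg.
exact: gens_ip.
Qed.

Lemma hull_ip : {in D &, forall u v, ip u v = 0}.
Proof. by move=> u v uD vD; apply: (dualP _ _ (subsetP hull_sub_dual _ uD)). Qed.

Lemma hull_even : {in D &, forall u v, ~~ odd #|supp u :&: supp v|}.
Proof. by move=> u v uD vD; rewrite -ip_eq0 hull_ip. Qed.

Lemma hull_wt4 : {in D, forall u, (4 %| wt u)%N}.
Proof.
pose K := [set x in D | (4 %| wt x)%N].
have gK : group_set K.
  apply/group_setP; split=> [|x y]; first by rewrite inE group1 zmod1gE wt0.
  rewrite !inE => /andP[xD /dvdnP[k xk]] /andP[yD /dvdnP[l yl]].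
  rewrite zmodMgE hullD //=.
  have := wt_add x y; have := hull_even xD yD; rewrite xk yl.
  by move: (wt _) #|_|; lia.
move=> u; suff /subsetP h : D \subset Group gK by move/h; rewrite inE => /andP[].
rewrite gen_subG; apply/subsetP=> u' ug; rewrite !inE mem_gen //=.
have g0 : 0 \in gens by rewrite inE C0 orbT.
by have := gens_wt4 ug g0; rewrite addr0.
Qed.

(** The hull has dimension at most 10, as it is self-orthogonal, and not 10:
    in the field with five elements, [3 ^ 20 = 1] but [2 ^ 10 = -1]. *)
Lemma hull_card_exp : exists2 k, (8 <= k <= 9)%N & #|D| = (2 ^ k)%N.
Proof.
have cD := card_dual D.
have [k _ Dk] : exists2 k, (k <= 20)%N & #|D| = (2 ^ k)%N.
  by apply/dvdn_pfactor => //; rewrite -cD dvdn_mulr.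
have [m _ Dm] : exists2 m, (m <= 20)%N & #|dual D| = (2 ^ m)%N.
  by apply/dvdn_pfactor => //; rewrite -cD dvdn_mull.
have km : (k + m = 20)%N.
  by apply/eqP; rewrite -(@eqn_exp2l 2) // expnD -Dk -Dm cD.
exists k => //; apply/andP; split.
  rewrite -(@leq_exp2l 2) // -Dk.
  have <- : #|C| = (2 ^ 8)%N by case/and3P: gC => _ /eqP-> _.
  by rewrite subset_leq_card ?sub_hull.
have km' : (k <= m)%N.
  by rewrite -(@leq_exp2l 2) // -Dk -Dm subset_leq_card ?hull_sub_dual.
suff : k <> m by lia.
move=> ekm; have dD : dual D = D.
  by apply/eqP; rewrite eq_sym eqEcard hull_sub_dual Dm Dk ekm leqnn.
have := gauss_sum dD hull_wt4; rewrite Dk natrX.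
have -> : k = (4 * 2 + 2)%N by lia.
have i4 : (2%:R : 'F_5) ^+ 4 = 1 by apply: val_inj.
have t4 : (3%:R : 'F_5) ^+ 4 = 1 by apply: val_inj.
by rewrite exprD exprM i4 -[20%N]/(4 * 5)%N exprM t4 !expr1n mul1r => /eqP.
Qed.

Lemma tetradP s : reflect (s \in D /\ wt s = 4%N) (s \in S).
Proof. by rewrite inE; apply: (iffP andP) => -[? /eqP]. Qed.

(** Words of weight 16 are the complements of the tetrads. *)
Lemma hull_second_moment : (4 * #|D| <= 256 * #|S| + 768)%N.
Proof.
pose S16 := [set s in D | wt s == 16%N].
have S16E : #|S16| = #|S|.
  rewrite -(card_imset S16 (@addWI 20 (allone 20))); apply: eq_card.
  suff h (s : W) : (s \in [set t + allone 20 | t in S16]) = (s \in S) by exact: h.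
  apply/imsetP/tetradP=> [[t]|[sD w]].
    rewrite inE => /andP[tD /eqP w] ->; rewrite hullDr ?hull_allone //.
    by split=> //; rewrite wt_addallone w.
  exists (s + allone 20); last by rewrite addWK.
  by rewrite inE hullDr ?hull_allone // sD wt_addallone w.
(* The weights are 0, 4, 8, 12, 16 and 20. *)
have key u : u \in D -> (20%:R - 2%:R * (wt u)%:R : int) ^+ 2 =
   16 + 128 * ((wt u == 4%N)%:R + (wt u == 16%N)%:R)
      + 384 * ((wt u == 0%N)%:R + (wt u == 20%N)%:R).
  move=> /hull_wt4 /dvdnP[k wk].
  have : (wt u <= 20)%N by rewrite -[20%N in X in (_ <= X)%N]card_ord max_card.
  rewrite wk; have: (k < 6 \/ 6 <= k)%N by lia.
  case=> h; last by lia.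
  by move=> _; move: k h {wk} => [|[|[|[|[|[|]]]]]].
have := sum_sqr_wt D; rewrite (eq_bigr _ key) !big_split /=.
rewrite -!mulr_sumr !big_split /= sumr_const.
have cnt k : \sum_(u in D) ((wt u == k)%:R : int) = #|[set s in D | wt s == k]|%:R.
  rewrite -sum1_card natr_sum [RHS](eq_bigl (fun u => (u \in D) && (wt u == k))).
    by rewrite big_mkcondr; apply: eq_bigr => u _; case: eqP.
  by move=> u; rewrite inE.
rewrite !cnt -/S -/S16 -/(tetrads C) -/S S16E.
have -> : [set s in D | wt s == 0%N] = [set 0].
  by apply/setP=> s; rewrite !inE wt_eq0 andbC; case: eqP => // ->; rewrite hull0.
have -> : [set s in D | wt s == 20%N] = [set allone 20].
  apply/setP=> s; rewrite !inE; apply/andP/eqP=> [[_ /eqP w]|->]; last first.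
    by rewrite hull_allone wt_allone.
  have /eqP : wt (s + allone 20) = 0%N by rewrite wt_addallone w.
  by rewrite wt_eq0 addr_eq0 oppW => /eqP.
rewrite !cards1; move: #|S| #|D| => a b.
lia.
Qed.

Lemma card_hull : #|D| = 512%N.
Proof.
have [k /andP[k8 k9] Dk] := hull_card_exp.
have [k9E|k9N] := eqVneq k 9%N; first by rewrite Dk k9E.
have {k8 k9 k9N}ek : k = 8%N by lia.
have D256 : #|D| = 256%N by rewrite Dk ek.
have CD : C = D.
  apply/eqP; rewrite eqEcard sub_hull D256.
  by case/and3P: gC => _ /eqP -> _.
have : S != set0.
  by rewrite -cards_eq0; have := hull_second_moment; rewrite D256; lia.
case/set0Pn=> s /tetradP[]; rewrite -CD => sC w.
have := code_wt8 sC C0; rewrite addr0 w -wt_eq0 w => h.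
by have := h isT.
Qed.

Lemma card_tetrads_ge : (5 <= #|S|)%N.
Proof. by have := hull_second_moment; rewrite card_hull; lia. Qed.

(** [C] and its translate by a word of weight 4 are disjoint, and each is half
    of the hull. *)
Lemma tetrad_flip s x : s \in S -> x \in D -> (x + s \in C) = (x \notin C).
Proof.
case/tetradP=> sD w xD.
have cC : #|C| = 256%N by case/and3P: gC => _ /eqP.
pose Cs := [set y + s | y in C].
have d y : y \in C -> y + s \notin C.
  move=> yC; apply/negP=> /(code_wt8 yC); rewrite addKW w => h.
  have : (8 <= 4)%N; last by [].
  apply: h; apply/eqP=> /(congr1 (+%R y)); rewrite addKW addWW => s0.
  by move: w; rewrite -s0 wt0.
have : D :\: C = Cs.
  apply/eqP; rewrite eq_sym eqEcard; apply/andP; split.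
    apply/subsetP=> _ /imsetP[y yC ->].
    by rewrite inE d //= hullD // (subsetP sub_hull).
  rewrite card_imset; last exact: addWI.
  by rewrite cardsD (setIidPr sub_hull) card_hull cC.
move/setP/(_ x); rewrite inE xD andbT => ->; apply/idP/imsetP=> [h|[y yC ->]].
  by exists (x + s); rewrite // addWK.
by rewrite addWK.
Qed.

(** The sum of two words of weight 4 lies in [C], so its weight is at least 8. *)
Lemma tetrads_disjoint s t : s \in S -> t \in S -> s != t ->
  supp s :&: supp t = set0.
Proof.
move=> sS tS ne; have [sD ws] := tetradP _ sS; have [tD wtt] := tetradP _ tS.
have stC : s + t \in C.
  by rewrite tetrad_flip // -[s]add0r tetrad_flip ?hull0 // C0.
have := code_wt8 stC C0; rewrite addr0 addr_eq0 oppW ne => /(_ isT).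
have := wt_add s t; rewrite ws wtt => e h; apply/eqP; rewrite -cards_eq0.
by apply/eqP; move: e h; move: #|_ :&: _| (wt _); lia.
Qed.

End Hull.

(** * Equivalences of codes *)

Section Equivalences.

Local Open Scope ring_scope.

Variable n : nat.

Implicit Types (s : 'S_n) (u v : 'rV['F_2]_n) (C : {set 'rV['F_2]_n}).

(** The action of a permutation of the coordinates. *)
Definition pm s u : 'rV['F_2]_n := \row_i u 0 (s i).

Lemma pm0 s : pm s 0 = 0.
Proof. by apply/rowP=> i; rewrite !mxE. Qed.

Lemma pmD s u v : pm s (u + v) = pm s u + pm s v.
Proof. by apply/rowP=> i; rewrite !mxE. Qed.

Lemma pm_allone s : pm s (allone n) = allone n.
Proof. by apply/rowP=> i; rewrite !mxE. Qed.

Lemma pm_inj s : injective (pm s).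
Proof.
move=> u v /rowP uv; apply/rowP=> i; have := uv (s^-1%g i).
by rewrite !mxE permKV.
Qed.

Lemma wt_pm s u : wt (pm s u) = wt u.
Proof.
rewrite /wt -(card_imset (mem (supp (pm s u))) (@perm_inj _ s)).
apply: eq_card => i; apply/imsetP/idP=> [[j]|].
  by rewrite !inE mxE => uj ->.
by rewrite inE => ui; exists (s^-1%g i); rewrite ?permKV // inE mxE permKV.
Qed.

(** An equivalence is a coordinate permutation followed by a translation. *)
Lemma word_mapE s p u : word_map s p u = pm s u + word_map s p 0.
Proof.
apply/rowP=> i; rewrite !mxE.
have : p i 0 != p i 1 by rewrite (inj_eq perm_inj).
case: (F2_cases (p i 0)) => e0; case: (F2_cases (p i 1)) => e1; rewrite e0 e1 //= => _;
  case: (F2_cases (u 0 (s i))) => ->; rewrite ?e0 ?e1 ?addFF2 ?addr0 ?add0r //.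
Qed.

Lemma word_map_inj s p : injective (word_map s p).
Proof.
by move=> u v; rewrite word_mapE [in RHS]word_mapE => /addWI /pm_inj.
Qed.

Lemma word_mapD s p u v : word_map s p u + word_map s p v = pm s (u + v).
Proof.
rewrite word_mapE [X in _ + X]word_mapE pmD addrACA addWW addr0 //.
Qed.

Lemma word_map3 s p u v w :
  word_map s p (u + v + w) = word_map s p u + word_map s p v + word_map s p w.
Proof. by rewrite word_mapD word_mapE [in RHS]word_mapE addrA !pmD. Qed.

Lemma word_map_allone s p u :
  word_map s p (u + allone n) = word_map s p u + allone n.
Proof. by rewrite word_mapE pmD pm_allone addrAC -word_mapE. Qed.

Lemma dist_word_map s p u v :
  hamming_dist (word_map s p u) (word_map s p v) = hamming_dist u v.
Proof. by rewrite !hamming_distE word_mapD wt_pm. Qed.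

Lemma code_equiv_word_map s p C : code_equiv C [set word_map s p u | u in C].
Proof. by apply/code_equivP; exists s, p. Qed.

Lemma pm_word_map s u : word_map s [ffun=> 1%g] u = pm s u.
Proof. by apply/rowP=> i; rewrite !mxE ffunE perm1. Qed.

Lemma code_equiv_pm s C : code_equiv C [set pm s u | u in C].
Proof.
apply/code_equivP; exists s, [ffun=> 1%g]; apply: eq_imset => u.
by rewrite pm_word_map.
Qed.

Lemma translate_word_map v u :
  word_map 1%g [ffun i => tperm 0 (v 0 i)] u = u + v.
Proof.
apply/rowP=> i; rewrite !mxE ffunE perm1.
case: (F2_cases (v 0 i)) => ->; first by rewrite tperm1 perm1 addr0.
by case: (F2_cases (u 0 i)) => ->; rewrite ?tpermL ?tpermR ?add0r ?addFF2.
Qed.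

Lemma is_code_word_map d s p C :
  is_code d C -> is_code d [set word_map s p u | u in C].
Proof.
move=> /forall_inP h; apply/forall_inP=> _ /imsetP[u uC ->].
apply/forall_inP=> _ /imsetP[v vC ->]; rewrite dist_word_map.
rewrite (inj_eq (@word_map_inj s p)).
by have /forall_inP := h _ uC; apply.
Qed.

Lemma dists_divisible_word_map k s p C :
  dists_divisible k C -> dists_divisible k [set word_map s p u | u in C].
Proof.
move=> /forall_inP h; apply/forall_inP=> _ /imsetP[u uC ->].
apply/forall_inP=> _ /imsetP[v vC ->]; rewrite dist_word_map.
by have /forall_inP := h _ uC; apply.
Qed.

End Equivalences.

(** * The tetrads in standard position *)

Section StandardTetrads.

Local Open Scope ring_scope.

Notation W := 'rV['F_2]_20.

Implicit Types (C : {set W}) (u v x d e f : W) (s : 'S_20).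

Lemma good_word_map s p C : good C -> good [set word_map s p u | u in C].
Proof.
case/and3P=> c8 cC d4; apply/and3P; split.
- exact: is_code_word_map.
- by rewrite card_imset //; apply: word_map_inj.
exact: dists_divisible_word_map.
Qed.

Lemma good_pm s C : good C -> good [set pm s u | u in C].
Proof.
move=> /(@good_word_map s [ffun=> 1%g]); congr (good _).
by apply: eq_imset => u; rewrite pm_word_map.
Qed.

Lemma hull_pm s C x : x \in hull C -> pm s x \in hull [set pm s u | u in C].
Proof.
pose K := [set x | pm s x \in hull [set pm s u | u in C]].
have gK : group_set K.
  apply/group_setP; split=> [|y z].
    by rewrite inE zmod1gE pm0; apply: group1.
  by rewrite !inE zmodMgE pmD; apply: groupM.
suff /subsetP h : hull C \subset Group gK by move/h; rewrite inE.
rewrite gen_subG; apply/subsetP=> y; rewrite !inE => /orP[/eqP->|yC].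
  by rewrite pm_allone; apply: hull_allone.
by apply: mem_gen; rewrite !inE imset_f ?orbT.
Qed.

(** The word whose support is the [k]-th block [{4k, ..., 4k+3}]. *)
Definition tet k : W := \row_j (j %/ 4 == k)%N%:R.

Lemma block_lt5 (j : 'I_20) : (j %/ 4 < 5)%N.
Proof. by have := ltn_ord j; lia. Qed.

(** The coordinates can be numbered so that the words of weight 4 of the hull
    include the five blocks of consecutive coordinates. *)
Lemma tetrads_standard C : good C -> 0 \in C ->
  exists s, forall k, (k < 5)%N -> tet k \in hull [set pm s u | u in C].
Proof.
move=> gC C0; pose t k := nth 0 (enum (tetrads C)) k.
have tS (k : nat) : (k < 5)%N -> t k \in tetrads C.
  move=> k5; rewrite -mem_enum mem_nth // -cardE.
  exact: leq_trans k5 (card_tetrads_ge gC C0).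
have dis k l : (k < 5)%N -> (l < 5)%N -> k != l -> supp (t k) :&: supp (t l) = set0.
  move=> k5 l5 kl; apply: (tetrads_disjoint gC C0); rewrite ?tS //.
  have c5 := card_tetrads_ge gC C0; rewrite cardE in c5.
  by rewrite nth_uniq ?enum_uniq //; apply: leq_trans c5.
have sz k : (k < 5)%N -> size (enum (supp (t k))) = 4%N.
  by move=> /tS /tetradP[_]; rewrite /wt cardE.
have b5 := block_lt5.
(* [f] numbers the points of the [k]-th tetrad by [4k], ..., [4k+3]. *)
pose f (j : 'I_20) := nth j (enum (supp (t (j %/ 4)%N))) (j %% 4)%N.
have fS j : f j \in supp (t (j %/ 4)%N).
  by rewrite -mem_enum mem_nth // sz ?b5 // ltn_mod.
have f_inj : injective f.
  move=> i j fij; have [eb|nb] := eqVneq (i %/ 4)%N (j %/ 4)%N; last first.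
    have /setP/(_ (f i)) := dis _ _ (b5 i) (b5 j) nb.
    by rewrite [in RHS]inE in_setI fS fij fS.
  have := fij; rewrite /f eb (set_nth_default j) ?sz ?b5 ?ltn_mod //.
  move/eqP; rewrite nth_uniq ?enum_uniq ?sz ?b5 ?ltn_mod // => /eqP em.
  by apply: val_inj; rewrite /= (divn_eq i 4) (divn_eq j 4) eb em.
exists (perm f_inj) => k k5.
suff -> : tet k = pm (perm f_inj) (t k).
  by apply: hull_pm; have /tetradP[] := tS _ k5.
apply/rowP=> j; rewrite !mxE permE; case: eqP => [<-|/eqP nb].
  by have := fS j; rewrite inE F2_neq0 => /eqP->.
have /setP/(_ (f j)) := dis _ _ (b5 j) k5 nb.
rewrite in_setI fS [in RHS]inE /= inE; by move/negbFE/eqP=> ->.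
Qed.

End StandardTetrads.

(** * The hull modulo the tetrads *)

Section StandardHull.

Local Open Scope ring_scope.

Notation W := 'rV['F_2]_20.

Implicit Types (u v d e f : W) (j k l : nat).

(** The [j]-th bit of a word, for a plain number [j]. *)
Definition bt (u : W) (j : nat) : 'F_2 := u 0 (inord j).

Lemma btD u v j : bt (u + v) j = bt u j + bt v j.
Proof. exact: mxE. Qed.

Lemma bt_ord u (j : 'I_20) : u 0 j = bt u j.
Proof. by rewrite /bt inord_val. Qed.

Lemma bt_tet k j : (j < 20)%N -> bt (tet k) j = (j %/ 4 == k)%N%:R.
Proof. by move=> j20; rewrite /bt mxE inordK. Qed.

Lemma wt_bt u : wt u = (\sum_(0 <= j < 20) (bt u j != 0)%R)%N.
Proof.
rewrite big_mkord /wt -sum1_card big_mkcond; apply: eq_bigr => j _.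
by rewrite inE bt_ord; case: (_ != _).
Qed.

Lemma ip_bt u v : ip u v = \sum_(0 <= j < 20) bt u j * bt v j.
Proof. by rewrite big_mkord; apply: eq_bigr => j _; rewrite !bt_ord. Qed.

Variable C : {set W}.
Hypotheses (gC : good C) (C0 : 0 \in C).

Let D := hull C.

Hypothesis tetD : forall k, (k < 5)%N -> tet k \in D.

(** A word of the hull is orthogonal to each tetrad. *)
Lemma block_even d k : d \in D -> (k < 5)%N ->
  bt d (4 * k) + bt d (4 * k + 1) + bt d (4 * k + 2) + bt d (4 * k + 3) = 0.
Proof.
move=> dD k5; have := hull_ip gC C0 dD (tetD k5); rewrite ip_bt => <-.
rewrite /index_iota unlock /= !bt_tet //.
by case: k k5 => [|[|[|[|[|]]]]] //= _;
  rewrite ?mulr0 ?mulr1 ?addr0 ?add0r ?addrA.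
Qed.

(** Words of the hull that vanish at the first point of each block; they
    represent the hull modulo the tetrads. *)
Definition based d := d \in D /\ forall k, (k < 5)%N -> bt d (4 * k) = 0.

(** A based word vanishes on the [k]-th block; its bits at [4k] and [4k+3] are
    determined by the other two. *)
Definition block0 (d : W) k := (bt d (4 * k + 1) == 0) && (bt d (4 * k + 2) == 0).

Lemma basedD d e : based d -> based e -> based (d + e).
Proof.
move=> [dD d0] [eD e0]; split=> [|k k5]; first by rewrite groupM.
by rewrite btD d0 // e0 // addr0.
Qed.

Lemma based_last d k : based d -> (k < 5)%N ->
  bt d (4 * k + 3) = bt d (4 * k + 1) + bt d (4 * k + 2).
Proof.
move=> [dD d0] k5; have := block_even dD k5; rewrite d0 // add0r.
by move/eqP; rewrite addF2_eq0 eq_sym => /eqP.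
Qed.

Lemma based_zero d : based d -> (forall k, (k < 5)%N -> block0 d k) -> d = 0.
Proof.
move=> bd z; apply/rowP=> j; rewrite bt_ord mxE (divn_eq j 4) mulnC.
have k5 := block_lt5 j.
have /andP[/eqP e1 /eqP e2] := z _ k5; have e3 := based_last bd k5.
have : (j %% 4 < 4)%N by rewrite ltn_mod.
case: (j %% 4)%N => [|[|[|[|]]]] //= _; rewrite ?addn0 ?(proj2 bd) //.
by rewrite e3 e1 e2 addr0.
Qed.

Lemma wt_based d : based d ->
  wt d = (2 * (~~ block0 d 0 + ~~ block0 d 1 + ~~ block0 d 2 + ~~ block0 d 3
               + ~~ block0 d 4))%N.
Proof.
move=> bd; have h k : (k < 5)%N ->
    ((bt d (4 * k)%N != 0)%R + (bt d (4 * k + 1)%N != 0)%R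
     + (bt d (4 * k + 2)%N != 0)%R + (bt d (4 * k + 3)%N != 0)%R
     = 2 * ~~ block0 d k)%N.
  move=> k5; rewrite (proj2 bd) // (based_last bd) // /block0 addF2_eq0.
  by case: (F2_cases (bt d (4 * k + 1))) => ->;
     case: (F2_cases (bt d (4 * k + 2))) => ->.
rewrite !mulnDr -!h // wt_bt /index_iota unlock /=.
by rewrite !addnA addn0.
Qed.

(** A nonzero based word vanishes on at most one block.  Its weight is twice
    the number of blocks on which it does not vanish; if this number is at most
    3, then it is 2 as 4 divides the weight, and the word has weight 4.  It
    then has to be disjoint from the tetrads, which cover all coordinates. *)
Lemma two_blocks d k l : based d -> (k < 5)%N -> (l < 5)%N -> k != l ->
  block0 d k -> block0 d l -> d = 0.
Proof.
move=> bd k5 l5 kl zk zl.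
have : (forall m, (m < 5)%N -> block0 d m) \/ wt d = 4%N.
  have := hull_wt4 gC C0 (proj1 bd); rewrite (wt_based bd).
  have : [&& block0 d 0, block0 d 1, block0 d 2, block0 d 3 & block0 d 4] ->
      forall m, (m < 5)%N -> block0 d m.
    by case/and5P=> ? ? ? ? ? [|[|[|[|[|]]]]].
  move: k l k5 l5 kl zk zl => [|[|[|[|[|k]]]]] [|[|[|[|[|l]]]]] //= _ _ _;
    case: (block0 d 0); case: (block0 d 1); case: (block0 d 2);
    case: (block0 d 3); case: (block0 d 4) => //= _ _ h; auto.
case=> [|wd]; first exact: based_zero.
have [j jd] : exists j : 'I_20, j \in supp d.
  by apply/set0Pn; rewrite -cards_eq0 -/(wt d) wd.
have b5 := block_lt5 j.
have dT : d \in tetrads C by apply/tetradP; rewrite wd (proj1 bd).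
have tT : tet (j %/ 4)%N \in tetrads C.
  apply/tetradP; rewrite tetD //; split=> //.
  rewrite wt_bt /index_iota unlock /= !bt_tet //.
  by case: (j %/ 4)%N b5 => [|[|[|[|[|]]]]].
have ne : d != tet (j %/ 4)%N.
  apply/eqP=> e; have := proj2 bd _ b5; rewrite {1}e bt_tet; last by lia.
  by rewrite mulKn // eqxx.
have /setP/(_ j) := tetrads_disjoint gC C0 dT tT ne.
by rewrite in_setI jd [in RHS]inE inE mxE eqxx.
Qed.

(** The values on two blocks of a based word can be prescribed: the map that
    reads off these values and the first bits of all blocks is injective from
    the hull to a set of the same size. *)
Lemma based_exists k l y1 y2 z1 z2 : (k < 5)%N -> (l < 5)%N -> k != l ->
  exists2 d, based d & [/\ bt d (4 * k + 1) = y1, bt d (4 * k + 2) = y2,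
                          bt d (4 * l + 1) = z1 & bt d (4 * l + 2) = z2].
Proof.
move=> k5 l5 kl.
pose ps := [:: 0; 4; 8; 12; 16; 4 * k + 1; 4 * k + 2; 4 * l + 1; 4 * l + 2]%N.
pose ev (d : W) : {ffun 'I_9 -> 'F_2} := [ffun i : 'I_9 => bt d (nth 0%N ps i)].
have evE d d' : ev d = ev d' -> forall i, (i < 9)%N ->
    bt (d + d') (nth 0%N ps i) = 0.
  move/ffunP=> e i i9; have := e (Ordinal i9); rewrite !ffunE /= => e'.
  by rewrite btD e' addFF2.
have ev_inj : {in D &, injective ev}.
  move=> d d' dD d'D /evE z; have b : based (d + d').
    split; first exact: groupM.
    by move=> [|[|[|[|[|]]]]] // _; [apply: (z 0%N) | apply: (z 1%N)
      | apply: (z 2%N) | apply: (z 3%N) | apply: (z 4%N)].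
  have /eqP : d + d' = 0.
    apply: (two_blocks b k5 l5 kl); apply/andP; split; apply/eqP.
    - exact: (z 5%N).
    - exact: (z 6%N).
    - exact: (z 7%N).
    exact: (z 8%N).
  by rewrite addr_eq0 oppW => /eqP.
have im : ev @: D = setT.
  apply/eqP; rewrite eqEcard subsetT cardsT card_ffun card_Fp // card_ord.
  by rewrite card_in_imset ?card_hull.
have : [ffun i : 'I_9 => nth 0 [:: 0; 0; 0; 0; 0; y1; y2; z1; z2] i] \in ev @: D.
  by rewrite im inE.
case/imsetP=> d dD /ffunP e; exists d.
  split=> // -[|[|[|[|[|]]]]] // _; first [
    by have := e (inord 0); rewrite !ffunE inordK
  | by have := e (inord 1); rewrite !ffunE inordK
  | by have := e (inord 2); rewrite !ffunE inordK
  | by have := e (inord 3); rewrite !ffunE inordK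
  | by have := e (inord 4); rewrite !ffunE inordK ].
by split; [have := e (inord 5) | have := e (inord 6) | have := e (inord 7)
  | have := e (inord 8)]; rewrite !ffunE inordK.
Qed.

(** Based words whose sum vanishes on a block agree there. *)
Lemma block0D_eq d e k : based d -> based e -> (k < 5)%N -> block0 (d + e) k ->
  forall r, (r < 4)%N -> bt d (4 * k + r) = bt e (4 * k + r).
Proof.
move=> bd be k5 /andP[]; rewrite !btD !addF2_eq0 => /eqP e1 /eqP e2.
move=> [|[|[|[|]]]] // _; first by rewrite addn0 (proj2 bd) // (proj2 be).
by rewrite !based_last // e1 e2.
Qed.

(** Modulo the tetrads, every block carries only three nonzero values; if [d],
    [e] and [d + e] take them, then any [f] agrees on the block with [0] or one
    of these words. *)
Lemma block_span d e f k :
  ~~ block0 d k -> ~~ block0 e k -> ~~ block0 (d + e) k ->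
  [|| block0 f k, block0 (f + d) k, block0 (f + e) k | block0 (f + (d + e)) k].
Proof.
rewrite /block0 !btD.
by case: (F2_cases (bt d (4 * k + 1))) => ->; case: (F2_cases (bt d (4 * k + 2))) => ->;
 case: (F2_cases (bt e (4 * k + 1))) => ->; case: (F2_cases (bt e (4 * k + 2))) => ->;
 case: (F2_cases (bt f (4 * k + 1))) => ->; case: (F2_cases (bt f (4 * k + 2))) => ->.
Qed.

End StandardHull.

(** * Uniqueness of the hull *)

Section StandardForm.

Local Open Scope ring_scope.

Notation W := 'rV['F_2]_20.

(** The word whose bits are the binary digits of [m]. *)
Definition wordN (m : N) : W := \row_j (N.testbit m (N.of_nat j))%:R.

(** A basis of the standard code: four words followed by the five tetrads.
    In a block, the hexadecimal digits [A], [C] and [6] stand for the elements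
    [1], [w] and [w^2] of the field with four elements; the last digit is the
    block number 0.  The four words are [(1, 0, 1, 1, 1)], [(0, 1, 1, w, w^2)]
    and their multiples by [w], in the order
    [(1, 0, 1, 1, 1)], [(w, 0, w, w, w)], [(0, 1, 1, w, w^2)],
    [(0, w, w, w^2, 1)]. *)
Definition basisN : seq N :=
  [:: 0xAAA0A; 0xCCC0C; 0x6CAA0; 0xA6CC0;
      0xF; 0xF0; 0xF00; 0xF000; 0xF0000]%num.

Implicit Types (u v d e f : W) (k l : nat).

Lemma block_point_lt20 k i : (k < 5)%N -> (i < 4)%N -> (4 * k + i < 20)%N.
Proof. lia. Qed.

Lemma block_digits (i j : nat) : (i %/ 4 = j %/ 4)%N -> odd i = odd j ->
  odd i./2 = odd j./2 -> i = j.
Proof. lia. Qed.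

Section Frame.

Variable C : {set W}.
Hypotheses (gC : good C) (C0 : 0 \in C).
Hypothesis tetD : forall k, (k < 5)%N -> tet k \in hull C.

Notation based := (based C).

Let based_D d : based d -> d \in hull C. Proof. by case. Qed.

(** If [d], [e] and [d + e] do not vanish on a block, then the pairs of bits of
    [d] and [e] at the four points of the block are all different. *)
Lemma block_frame d e k (a b : bool) : based d -> based e -> (k < 5)%N ->
  ~~ block0 d k -> ~~ block0 e k -> ~~ block0 (d + e) k ->
  exists r, [/\ (r < 4)%N, bt d (4 * k + r) = a%:R & bt e (4 * k + r) = b%:R].
Proof.
move=> bd be k5.
have d3 := based_last gC C0 tetD bd k5; have e3 := based_last gC C0 tetD be k5.
have d0 := proj2 bd _ k5; have e0 := proj2 be _ k5.
pose dv := [:: 0; bt d (4 * k + 1); bt d (4 * k + 2);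
  bt d (4 * k + 1) + bt d (4 * k + 2)].
pose ev := [:: 0; bt e (4 * k + 1); bt e (4 * k + 2);
  bt e (4 * k + 1) + bt e (4 * k + 2)].
have dE r : (r < 4)%N -> bt d (4 * k + r) = nth 0 dv r.
  by case: r => [|[|[|[|]]]] //=; rewrite addn0.
have eE r : (r < 4)%N -> bt e (4 * k + r) = nth 0 ev r.
  by case: r => [|[|[|[|]]]] //=; rewrite addn0.
move=> nd ne nde.
suff : has (fun r => (nth 0 dv r == a%:R) && (nth 0 ev r == b%:R)) (iota 0 4).
  case/hasP=> r; rewrite mem_iota => /andP[_ r4] /andP[/eqP rd /eqP re].
  by exists r; rewrite dE // eE.
move: nd ne nde; rewrite /block0 !btD /dv /ev /=.
by case: (F2_cases (bt d (4 * k + 1))) => ->; case: (F2_cases (bt d (4 * k + 2))) => ->;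
 case: (F2_cases (bt e (4 * k + 1))) => ->; case: (F2_cases (bt e (4 * k + 2))) => ->;
 case: a; case: b.
Qed.

(** Four words of the hull that are related to each other, on every block, as
    the first four words of the standard basis: on block 1 the words [r] and
    [t], and on the other blocks the words [p] and [q], serve as coordinates. *)
Lemma hexacode_frame : exists2 pqrt : W * W * (W * W),
  let: ((p, q), (r, t)) := pqrt in
  [/\ based p, based q, based r & based t] &
  let: ((p, q), (r, t)) := pqrt in
  [/\ [/\ block0 p 1, block0 q 1, block0 r 0 & block0 t 0],
      forall k, (k < 5)%N ->
        let: (x, y) := if k == 1%N then (r, t) else (p, q) in
        [/\ ~~ block0 x k, ~~ block0 y k & ~~ block0 (x + y) k],
      [/\ block0 (r + p) 2, block0 (r + q) 3 & block0 (r + (p + q)) 4] &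
      [/\ block0 (t + q) 2, block0 (t + (p + q)) 3 & block0 (t + p) 4]].
Proof.
have ex := based_exists gC C0 tetD.
have two d k l : based d -> (k < 5)%N -> (l < 5)%N -> k != l ->
    block0 d k -> ~~ block0 d l -> forall m, (m < 5)%N -> m != k -> ~~ block0 d m.
  move=> bd k5 l5 kl zk nl m m5 mk; apply: contra nl => zm.
  have -> : d = 0 by apply: (two_blocks gC C0 tetD bd k5 m5); rewrite // eq_sym.
  by rewrite /block0 /bt !mxE.
have bD := @basedD C.
have [p bp [p1 p2 p3 p4]] := ex 0%N 1%N 1 0 0 0 isT isT isT.
have [q0 bq0 [q1 q2 q3 q4]] := ex 0%N 1%N 0 1 0 0 isT isT isT.
have [r br [r1 r2 r3 r4]] :=
  ex 0%N 2%N 0 0 (bt p (4 * 2 + 1)) (bt p (4 * 2 + 2)) isT isT isT.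
have np := two p 1%N 0%N bp isT isT isT.
have nq0 := two q0 1%N 0%N bq0 isT isT isT.
have npq0 := two (p + q0) 1%N 0%N (bD _ _ bp bq0) isT isT isT.
rewrite /block0 p1 p2 p3 p4 in np; have {}np := np isT isT.
rewrite /block0 q1 q2 q3 q4 in nq0; have {}nq0 := nq0 isT isT.
rewrite /block0 !btD p1 p2 p3 p4 q1 q2 q3 q4 in npq0; have {}npq0 := npq0 isT isT.
have rp2 : block0 (r + p) 2 by rewrite /block0 !btD r3 r4 !addFF2.
have r0 : block0 r 0 by rewrite /block0 r1 r2.
have nr := two r 0%N 2%N br isT isT isT r0.
have {}nr : forall m, (m < 5)%N -> m != 0%N -> ~~ block0 r m.
  by apply: nr; rewrite /block0 r3 r4; apply: np.
have nrp := two (r + p) 2%N 0%N (bD _ _ br bp) isT isT isT rp2.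
have {}nrp : forall m, (m < 5)%N -> m != 2%N -> ~~ block0 (r + p) m.
  by apply: nrp; rewrite /block0 !btD r1 r2 p1 p2.
(* Up to replacing [q] by [p + q], the words [q] and [r] agree on block 3. *)
have [q [bq q_1 rq3 nq [npq q_0]]] : exists q,
    [/\ based q, block0 q 1, block0 (r + q) 3,
    forall m, (m < 5)%N -> m != 1%N -> ~~ block0 q m &
    (forall m, (m < 5)%N -> m != 1%N -> ~~ block0 (p + q) m)
    /\ bt q (4 * 0 + 2) = 1].
  have := block_span r (np 3%N isT isT) (nq0 3%N isT isT) (npq0 3%N isT isT).
  rewrite (negbTE (nr 3%N isT isT)) (negbTE (nrp 3%N isT isT)) /= => /orP[h|h].
    by exists q0; split=> //; rewrite /block0 q3 q4.
  exists (p + q0); split=> //; first exact: bD.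
    by rewrite /block0 !btD p3 p4 q3 q4.
  split; last by rewrite btD p2 q2 add0r.
  by move=> m m5 m1; rewrite addKW; apply: nq0.
have [t bt' [t1 t2 t3 t4]] :=
  ex 0%N 2%N 0 0 (bt q (4 * 2 + 1)) (bt q (4 * 2 + 2)) isT isT isT.
have tq2 : block0 (t + q) 2 by rewrite /block0 !btD t3 t4 !addFF2.
have t0 : block0 t 0 by rewrite /block0 t1 t2.
have nt : forall m, (m < 5)%N -> m != 0%N -> ~~ block0 t m.
  by apply: (two t 0%N 2%N) => //; rewrite /block0 t3 t4; apply: nq.
have rt0 : block0 (r + t) 0 by rewrite /block0 !btD r1 r2 t1 t2.
have nrt : forall m, (m < 5)%N -> m != 0%N -> ~~ block0 (r + t) m.
  apply: (two (r + t) 0%N 2%N) => //; first exact: bD.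
  have := npq 2%N isT isT; rewrite /block0 !btD r3 r4 t3 t4; exact.
have nrq : forall m, (m < 5)%N -> m != 3%N -> ~~ block0 (r + q) m.
  apply: (two (r + q) 3%N 0%N) => //; first exact: bD.
  by rewrite /block0 !btD r1 r2 q_0 andbF.
have ntq : forall m, (m < 5)%N -> m != 2%N -> ~~ block0 (t + q) m.
  apply: (two (t + q) 2%N 0%N) => //; first exact: bD.
  by rewrite /block0 !btD t1 t2 q_0 andbF.
have rpq4 : block0 (r + (p + q)) 4.
  have := block_span r (np 4%N isT isT) (nq 4%N isT isT) (npq 4%N isT isT).
  rewrite (negbTE (nr 4%N _ _)) // (negbTE (nrp 4%N _ _)) //.
  by rewrite (negbTE (nrq 4%N _ _)).
have tp4 : block0 (t + p) 4.
  have := block_span t (np 4%N isT isT) (nq 4%N isT isT) (npq 4%N isT isT).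
  rewrite (negbTE (nt 4%N _ _)) // (negbTE (ntq 4%N _ _)) //= => /orP[//|h].
  have := nrt 4%N isT isT; move: rpq4 h; rewrite /block0 !btD !addF2_eq0.
  by move=> /andP[/eqP-> /eqP->] /andP[/eqP-> /eqP->]; rewrite !eqxx.
have ntp : forall m, (m < 5)%N -> m != 4%N -> ~~ block0 (t + p) m.
  apply: (two (t + p) 4%N 0%N) => //; first exact: bD.
  by rewrite /block0 !btD t1 t2 p1 p2.
have tpq3 : block0 (t + (p + q)) 3.
  have := block_span t (np 3%N isT isT) (nq 3%N isT isT) (npq 3%N isT isT).
  rewrite (negbTE (nt 3%N _ _)) // (negbTE (ntp 3%N _ _)) //.
  by rewrite (negbTE (ntq 3%N _ _)).
exists ((p, q), (r, t)); first by split.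
split; [by split=> //; rewrite /block0 p3 p4| |by split|by split].
move=> k k5; have [->|k1] := eqVneq k 1%N.
  by split; [apply: nr|apply: nt|apply: nrt].
by split; [apply: np|apply: nq|apply: npq].
Qed.

(** The point of a block with coordinates [a] and [b] is given the number
    [a + 2b] inside its block. *)
Lemma basis_standard :
  exists s, forall i, (i < 9)%N ->
    wordN (nth 0%num basisN i) \in hull [set pm s u | u in C].
Proof.
have [[[p q] [r t]] [bp bq br bt'] [[zp zq zr zt] nz [r2 r3 r4] [t2 t3 t4]]] :=
  hexacode_frame.
have b5 := block_lt5.
pose xy k := if k == 1%N then (r, t) else (p, q).
have [g gP] : exists g : 'I_20 -> 'I_20, forall j, [/\ (g j %/ 4 = j %/ 4)%N,
    bt (xy (j %/ 4)%N).1 (g j) = (odd j)%:R & bt (xy (j %/ 4)%N).2 (g j) = (odd j./2)%:R].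
  suff h (j : 'I_20) : exists i : 'I_20, [/\ (i %/ 4 = j %/ 4)%N,
      bt (xy (j %/ 4)%N).1 i = (odd j)%:R & bt (xy (j %/ 4)%N).2 i = (odd j./2)%:R].
    by have [g gP] := fin_all_exists h; exists g.
  set k := (j %/ 4)%N.
  have [bx bY] : based (xy k).1 /\ based (xy k).2 by rewrite /xy; case: ifP.
  have [x0 y0 xy0] : [/\ ~~ block0 (xy k).1 k, ~~ block0 (xy k).2 k &
      ~~ block0 ((xy k).1 + (xy k).2) k].
    by have := nz _ (b5 j); rewrite -/k -/(xy k); case: (xy k).
  have [i [i4 ei1 ei2]] :=
    block_frame (odd j) (odd j./2) bx bY (b5 j) x0 y0 xy0.
  exists (Ordinal (block_point_lt20 (b5 j) i4)); split=> //=.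
  by rewrite mulnC divnMDl // (divn_small i4) addn0.
have g_inj : injective g.
  move=> i j gij; have [bi xi yi] := gP i; have [bj xj yj] := gP j.
  have eb : (i %/ 4 = j %/ 4)%N by rewrite -bi -bj gij.
  have ox : odd i = odd j.
    move: xi; rewrite eb gij xj.
    by case: (odd i); case: (odd j) => // /eqP.
  have oy : odd i./2 = odd j./2.
    move: yi; rewrite eb gij yj.
    by case: (odd i./2); case: (odd j./2) => // /eqP.
  exact/val_inj/block_digits.
exists (perm g_inj).
have gE (j : 'I_20) : (4 * (j %/ 4) + g j %% 4 = g j)%N.
  by have [<- _ _] := gP j; rewrite mulnC -divn_eq.
have eqB d e (j : 'I_20) : based d -> based e -> block0 (d + e) (j %/ 4) ->
    bt d (g j) = bt e (g j).
  move=> bd be z; rewrite -gE.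
  by apply: (block0D_eq gC C0 tetD bd be (b5 j) z); rewrite ltn_mod.
have b0 : based 0 by split=> [|k k5]; [exact: group1|rewrite /bt mxE].
have eq0 d (j : 'I_20) : based d -> block0 d (j %/ 4) -> bt d (g j) = 0.
  by move=> bd z; rewrite (eqB d 0) ?addr0 // /bt mxE.
have gen m d : d \in hull C ->
    (forall j : 'I_20, bt d (g j) = (N.testbit m (N.of_nat j))%:R) ->
    wordN m \in hull [set pm (perm g_inj) u | u in C].
  move=> dD h; suff -> : wordN m = pm (perm g_inj) d by apply: hull_pm.
  by apply/rowP=> j; rewrite !mxE permE bt_ord h.
have tetg k (j : 'I_20) : bt (tet k) (g j) = (j %/ 4 == k)%N%:R.
  by rewrite bt_tet //; have [-> _ _] := gP j.
have pj (j : 'I_20) : bt p (g j) = if (j %/ 4 == 1)%N then 0 else (odd j)%:R.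
  case: eqP => e; first by rewrite eq0 // e.
  by have [_ + _] := gP j; rewrite /xy; case: eqP e.
have qj (j : 'I_20) : bt q (g j) = if (j %/ 4 == 1)%N then 0 else (odd j./2)%:R.
  case: eqP => e; first by rewrite eq0 // e.
  by have [_ _] := gP j; rewrite /xy; case: eqP e.
have rj (j : 'I_20) : bt r (g j) = nth 0 [:: 0; (odd j)%:R; (odd j)%:R;
    (odd j./2)%:R; (odd j)%:R + (odd j./2)%:R] (j %/ 4).
  have := b5 j; case e : (j %/ 4)%N => [|[|[|[|[|]]]]] //= _.
  - by rewrite eq0 // e.
  - by have [_ + _] := gP j; rewrite e.
  - by rewrite (eqB r p) ?e // pj e.
  - by rewrite (eqB r q) ?e // qj e.
  rewrite (eqB r (p + q)) ?e //; last exact: basedD.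
  by rewrite btD pj qj e.
have tj (j : 'I_20) : bt t (g j) = nth 0 [:: 0; (odd j./2)%:R; (odd j./2)%:R;
    (odd j)%:R + (odd j./2)%:R; (odd j)%:R] (j %/ 4).
  have := b5 j; case e : (j %/ 4)%N => [|[|[|[|[|]]]]] //= _.
  - by rewrite eq0 // e.
  - by have [_ _] := gP j; rewrite e.
  - by rewrite (eqB t q) ?e // qj e.
  - rewrite (eqB t (p + q)) ?e //; last exact: basedD.
    by rewrite btD pj qj e.
  by rewrite (eqB t p) ?e // pj e.
move=> [|[|[|[|[|[|[|[|[|]]]]]]]]] // _;
 [ apply: (gen _ p (based_D bp)) | apply: (gen _ q (based_D bq))
 | apply: (gen _ r (based_D br)) | apply: (gen _ t (based_D bt'))
 | apply: (gen _ (tet 0%N) (@tetD 0%N isT)) | apply: (gen _ (tet 1%N) (@tetD 1%N isT))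
 | apply: (gen _ (tet 2%N) (@tetD 2%N isT)) | apply: (gen _ (tet 3%N) (@tetD 3%N isT))
 | apply: (gen _ (tet 4%N) (@tetD 4%N isT)) ];
 move=> j; rewrite ?pj ?qj ?rj ?tj ?tetg;
 case: j => j; do 20?[case: j => [|j] //]; by move=> ?; apply: val_inj.
Qed.

End Frame.
End StandardForm.

(** * Binary numbers as words *)

Section BinaryNumbers.

Local Open Scope ring_scope.

Notation W := 'rV['F_2]_20.

Implicit Types (a b m x y : N) (s : seq N).

Lemma F2_natb (b1 b2 : bool) : (b1%:R + b2%:R : 'F_2) = (b1 (+) b2)%:R.
Proof. by case: b1; case: b2; apply: val_inj. Qed.

Lemma F2_natb_inj (b1 b2 : bool) : (b1%:R : 'F_2) = b2%:R -> b1 = b2.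
Proof. by case: b1; case: b2 => // /eqP. Qed.

Lemma testbit_lxor a b i :
  N.testbit (N.lxor a b) i = N.testbit a i (+) N.testbit b i.
Proof. by rewrite N.lxor_spec; do 2!case: N.testbit. Qed.

Lemma wordN_lxor a b : wordN (N.lxor a b) = wordN a + wordN b.
Proof. by apply/rowP=> j; rewrite !mxE F2_natb testbit_lxor. Qed.

Lemma wordN0 : wordN 0 = 0.
Proof. by apply/rowP=> j; rewrite !mxE. Qed.

(** The number with binary digits [bs], least significant first. *)
Definition bitsN (bs : seq bool) : N :=
  foldr (fun (b : bool) m => if b then N.succ_double m else N.double m) 0%num bs.

Lemma testbit_bitsN bs i : N.testbit (bitsN bs) (N.of_nat i) = nth false bs i.
Proof.
elim: bs i => [|b bs IH] [|i] //=.
  case: b; first by rewrite N.succ_double_spec N.testbit_odd_0.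
  by rewrite N.double_spec N.testbit_even_0.
rewrite -IH -[N.pos _]/(N.of_nat i.+1) Nnat.Nat2N.inj_succ; case: b.
  by rewrite N.succ_double_spec N.testbit_odd_succ //; apply: N.le_0_l.
by rewrite N.double_spec N.testbit_even_succ //; apply: N.le_0_l.
Qed.

Lemma bitsN_inj x y : (forall i, N.testbit x (N.of_nat i) = N.testbit y (N.of_nat i)) ->
  x = y.
Proof. by move=> h; apply: N.bits_inj => i; rewrite -(Nnat.N2Nat.id i) h. Qed.

(** All sums of subfamilies of [s]. *)
Definition spanN s : seq N :=
  foldr (fun g l => l ++ [seq N.lxor g x | x <- l]) [:: 0%num] s.

Lemma mem_spanN_cons g s x :
  (x \in spanN (g :: s)) = (x \in spanN s) || (N.lxor g x \in spanN s).
Proof.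
rewrite mem_cat; congr (_ || _); apply/mapP/idP=> [[y ys ->]|gx].
  by rewrite -N.lxor_assoc N.lxor_nilpotent N.lxor_0_l.
by exists (N.lxor g x); rewrite // -N.lxor_assoc N.lxor_nilpotent N.lxor_0_l.
Qed.

Lemma spanN0 s : 0%num \in spanN s.
Proof. by elim: s => // g s IH; rewrite mem_spanN_cons IH. Qed.

Lemma spanN_lxor s : {in spanN s &, forall x y, N.lxor x y \in spanN s}.
Proof.
elim: s => [|g s IH] x y.
  by rewrite !inE => /eqP-> /eqP->.
rewrite !mem_spanN_cons => /orP[]hx /orP[]hy; apply/orP.
- by left; apply: IH.
- by right; rewrite N.lxor_comm N.lxor_assoc IH // N.lxor_comm.
- by right; rewrite -N.lxor_assoc IH.
left; suff -> : N.lxor x y = N.lxor (N.lxor g x) (N.lxor g y) by apply: IH.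
rewrite [N.lxor g x]N.lxor_comm N.lxor_assoc -[N.lxor g (N.lxor g y)]N.lxor_assoc.
by rewrite N.lxor_nilpotent N.lxor_0_l.
Qed.

(** Induction along a spanning family. *)
Lemma spanN_ind (P : N -> Prop) s :
  P 0%num -> (forall g x, g \in s -> P x -> P (N.lxor g x)) ->
  {in spanN s, forall x, P x}.
Proof.
move=> P0; elim: s => [|g s IH] h x; first by rewrite inE => /eqP->.
have {}IH : {in spanN s, forall x, P x}.
  by apply: IH => k y ks; apply: h; rewrite inE ks orbT.
rewrite mem_spanN_cons => /orP[/IH//|/IH] gx.
have := h g _ (mem_head _ _) gx.
by rewrite -N.lxor_assoc N.lxor_nilpotent N.lxor_0_l.
Qed.

(** The sum of the members of [s] selected by [bs]. *)
Definition combN (bs : seq bool) s : N :=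
  foldr (fun bg m => N.lxor (if bg.1 then bg.2 else 0%num) m) 0%num (zip bs s).

Lemma combN_span bs s : combN bs s \in spanN s.
Proof.
elim: s bs => [|g s IH] [|b bs]; [by []|by []|exact: spanN0|].
rewrite mem_spanN_cons /combN /= -/(combN _ _).
case: b; rewrite ?N.lxor_0_l ?IH //.
by rewrite -N.lxor_assoc N.lxor_nilpotent N.lxor_0_l IH orbT.
Qed.

End BinaryNumbers.

(** * The standard code and its subcodes *)

Section StandardCode.

Local Open Scope ring_scope.

Notation W := 'rV['F_2]_20.

Implicit Types (n m x y z f : N).

(** The standard doubly even code of dimension 9: its 512 words as numbers. *)
Definition stdN : seq N := spanN basisN.

Definition std : {set W} := [set w in [seq wordN n | n <- stdN]].

(** A class modulo the tetrads, given by its coordinates on the first four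
    basis words. *)
Definition quadN (p q r t : bool) : N := bitsN [:: p; q; r; t].

(** The class of a standard word.  On blocks 0 and 1, the sum of the bit at the
    first point and a bit at the second or third point is a coordinate. *)
Definition classN n : N :=
  let b := N.testbit n in
  quadN (b 0 (+) b 1)%num (b 0 (+) b 2)%num (b 4 (+) b 5)%num (b 4 (+) b 6)%num.

(** The parity of the number of tetrads in a standard word; the four other
    basis words vanish at the first point of each block. *)
Definition parityN n : bool :=
  let b := N.testbit n in b 0%num (+) b 4%num (+) b 8%num (+) b 12%num (+) b 16%num.

(** All classes, as the numbers from 0 to 15. *)
Definition classes : seq N := [seq N.of_nat k | k <- iota 0 16].

Lemma quadN_classes p q r t : quadN p q r t \in classes.
Proof. by case: p; case: q; case: r; case: t. Qed.

Lemma classN_classes n : classN n \in classes.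
Proof. exact: quadN_classes. Qed.

Lemma quadN_lxor p q r t p' q' r' t' :
  N.lxor (quadN p q r t) (quadN p' q' r' t') =
  quadN (p (+) p') (q (+) q') (r (+) r') (t (+) t').
Proof.
by case: p; case: q; case: r; case: t; case: p'; case: q'; case: r'; case: t'.
Qed.

Lemma classN_lxor n m : classN (N.lxor n m) = N.lxor (classN n) (classN m).
Proof.
rewrite /classN !testbit_lxor quadN_lxor.
congr (quadN _ _ _ _); exact: addbACA.
Qed.

Lemma parityN_lxor n m : parityN (N.lxor n m) = parityN n (+) parityN m.
Proof.
rewrite /parityN !testbit_lxor.
by do 10!case: N.testbit.
Qed.

Lemma testbit_table (F : N -> bool) z : z \in classes ->
  N.testbit (bitsN [seq F x | x <- classes]) z = F z.
Proof.
case/mapP=> k; rewrite mem_iota => /andP[_ k16] ->.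
rewrite testbit_bitsN (nth_map 0%num); last by rewrite size_map size_iota.
by rewrite (nth_map 0%N) ?size_iota // nth_iota.
Qed.

Lemma stdN_range : all (fun n => n <? 2 ^ 20)%num stdN.
Proof. by vm_compute. Qed.

Lemma stdN_uniq : uniq stdN.
Proof. by vm_compute. Qed.

Lemma size_stdN : size stdN = 512%N.
Proof. by vm_compute. Qed.

Lemma stdN_lxor : {in stdN &, forall n m, N.lxor n m \in stdN}.
Proof. exact: spanN_lxor. Qed.

Lemma wordN_inj : {in stdN &, injective wordN}.
Proof.
have big n : n \in stdN -> forall i, (20 <= i)%N -> N.testbit n (N.of_nat i) = false.
  move=> /(allP stdN_range) /N.ltb_lt lt i i20.
  have [->|n0] := eqVneq n 0%num; first exact: N.bits_0.
  apply: N.bits_above_log2; apply: (N.lt_le_trans _ 20).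
    by apply/N.log2_lt_pow2 => //; apply/N.neq_0_lt_0; apply/eqP.
  by lia.
move=> n m nS mS /rowP e; apply: bitsN_inj => i.
have [i20|i20] := ltnP i 20; last by rewrite !big.
by have := e (Ordinal i20); rewrite !mxE => /F2_natb_inj.
Qed.

Lemma mem_std n : n \in stdN -> wordN n \in std.
Proof. by move=> nS; rewrite inE map_f. Qed.

Lemma stdP w : reflect (exists2 n, n \in stdN & w = wordN n) (w \in std).
Proof. by rewrite inE; apply: mapP. Qed.

Lemma uniq_stdW : uniq [seq wordN n | n <- stdN].
Proof. by rewrite map_inj_in_uniq ?stdN_uniq //; apply: wordN_inj. Qed.

Lemma card_std : #|std| = 512%N.
Proof. by rewrite cardsE (card_uniqP uniq_stdW) size_map size_stdN. Qed.

Definition wtN n : nat := count (fun k => N.testbit n (N.of_nat k)) (iota 0 20).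

Lemma wt_wordN n : wt (wordN n) = wtN n.
Proof.
rewrite /wtN -sum1_count -/(index_iota 0 20) big_mkcond big_mkord.
rewrite /wt -sum1_card big_mkcond; apply: eq_bigr => j _; rewrite inE mxE.
by case: N.testbit.
Qed.

Definition tetradsN : seq N := [:: 0xF; 0xF0; 0xF00; 0xF000; 0xF0000]%num.

Lemma stdN_weights : all (fun n => [&& 4 %| wtN n &
  (wtN n < 8) ==> ((n == 0%num) || (n \in tetradsN))])%N stdN.
Proof. by vm_compute. Qed.

(** The subcode of the standard code attached to a function on the 16 classes,
    given by its table [f] as a 16-bit number: the words whose parity is the
    value of [f] at their class.  The other words are detected by [outN]. *)
Definition outN f n : bool := parityN n (+) N.testbit f (classN n).

Definition stdcode f : {set W} := [set w in [seq wordN n | n <- stdN & ~~ outN f n]].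

Lemma mem_stdcode f n : n \in stdN -> (wordN n \in stdcode f) = ~~ outN f n.
Proof.
move=> nS; rewrite inE; apply/mapP/idP=> [[m]|no].
  by rewrite mem_filter => /andP[mo mS] /wordN_inj ->.
by exists n; rewrite // mem_filter no.
Qed.

Lemma stdcodeP f w :
  reflect (exists n, [/\ n \in stdN, ~~ outN f n & w = wordN n]) (w \in stdcode f).
Proof.
rewrite inE; apply: (iffP mapP) => [[n]|[n [nS no ->]]].
  by rewrite mem_filter => /andP[? ?] ->; exists n.
by exists n; rewrite // mem_filter no.
Qed.

(** Each pair of a parity and a class occurs 16 times. *)
Lemma stdN_profile :
  perm_eq [seq (parityN n, classN n) | n <- stdN]
    (flatten (nseq 16 [seq (b, z) | b <- [:: false; true], z <- classes])).
Proof. by vm_compute. Qed.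

Lemma card_stdcode f : #|stdcode f| = 256%N.
Proof.
rewrite cardsE (card_uniqP _); last first.
  by rewrite map_inj_in_uniq ?filter_uniq ?stdN_uniq // => n m;
     rewrite !mem_filter => /andP[_ +] /andP[_]; apply: wordN_inj.
rewrite size_map size_filter.
pose a (bz : bool * N) := ~~ (bz.1 (+) N.testbit f bz.2).
rewrite (_ : count _ _ = count a [seq (parityN n, classN n) | n <- stdN]); last first.
  by rewrite count_map; apply: eq_count.
rewrite (seq.permP stdN_profile) count_flatten map_nseq.
suff -> : count a [seq (b, z) | b <- [:: false; true], z <- classes] = 16%N by [].
move: classes (erefl : size classes = 16%N) => cs <-.
rewrite /= cats0 count_cat !count_map.
by rewrite -(count_predC (fun z => ~~ N.testbit f z)); congr (_ + _)%N.
Qed.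

(** Distinct words at distance less than 8 would differ by a tetrad, which
    changes the parity but not the class. *)
Lemma good_stdcode f : good (stdcode f).
Proof.
have W n : n \in stdN ->
    (4 %| wtN n)%N /\ ((wtN n < 8)%N -> n = 0%num \/ n \in tetradsN).
  move=> /(allP stdN_weights) /andP[-> /implyP h].
  by split=> // /h /orP[/eqP|]; [left|right].
apply/and3P; split; last 1 first.
- apply/forall_inP=> _ /stdcodeP[n [nS no ->]].
  apply/forall_inP=> _ /stdcodeP[m [mS mo ->]].
  rewrite hamming_distE -wordN_lxor wt_wordN.
  by have [] := W _ (stdN_lxor nS mS).
- apply/forall_inP=> _ /stdcodeP[n [nS no ->]].
  apply/forall_inP=> _ /stdcodeP[m [mS mo ->]]; apply/implyP=> ne.
  rewrite hamming_distE -wordN_lxor wt_wordN leqNgt; apply/negP.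
  have [_ h] := W _ (stdN_lxor nS mS); case/h=> [|lT].
    by move/N.lxor_eq => e; rewrite e eqxx in ne.
  have [p1 c0] : parityN (N.lxor n m) /\ classN (N.lxor n m) = 0%num.
    have : all (fun l => parityN l && (classN l == 0%num)) tetradsN by [].
    by move/allP/(_ _ lT)/andP=> [? /eqP].
  move: no mo; rewrite /outN; rewrite classN_lxor in c0; move/N.lxor_eq: c0 => ->.
  by move: p1; rewrite parityN_lxor; case: (parityN n); case: (parityN m); case: N.testbit.
by apply/eqP/card_stdcode.
Qed.

End StandardCode.

(** * Reduction to fifteen representatives *)

Section Reduction.

Local Open Scope ring_scope.

Notation W := 'rV['F_2]_20.

Implicit Types (C : {set W}) (n m f g z : N).

Lemma hull_std C : good C -> 0 \in C ->
  (forall i, (i < 9)%N -> wordN (nth 0%num basisN i) \in hull C) ->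
  hull C = std :> {set W}.
Proof.
move=> gC C0 bC; apply/esym/eqP; rewrite eqEcard card_std (card_hull gC C0) leqnn andbT.
apply/subsetP=> _ /stdP[n nS ->]; move: n nS; apply: spanN_ind => [|g x gb xC].
  by rewrite wordN0; apply: group1.
rewrite wordN_lxor groupM //.
by move: (bC (index g basisN)); rewrite nth_index // index_mem; apply.
Qed.

(** The word of a given class that is a sum of the first four basis words. *)
Definition liftN z : N :=
  combN [:: N.testbit z 0; N.testbit z 1; N.testbit z 2; N.testbit z 3]%num basisN.

Lemma stdN_split : all (fun n => [&& liftN (classN n) \in stdN,
  ~~ parityN (liftN (classN n)) & N.lxor n (liftN (classN n)) \in spanN tetradsN]) stdN.
Proof. by vm_compute. Qed.

(** The table is read off at the lifts of the classes; [tetrad_flip] then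
    determines all other memberships. *)
Lemma good_stdcode_hull C : good C -> 0 \in C -> hull C = std :> {set W} ->
  exists bs, C = stdcode (bitsN bs) /\ size bs = 16%N.
Proof.
move=> gC C0 hC.
pose bs := [seq wordN (liftN z) \notin C | z <- classes]; exists bs.
split; last by rewrite size_map.
have bsE z : z \in classes -> N.testbit (bitsN bs) z = (wordN (liftN z) \notin C).
  exact: (testbit_table (fun z => wordN (liftN z) \notin C)).
have flip t : t \in spanN tetradsN -> forall n, n \in stdN ->
    (wordN (N.lxor n t) \in C) = (wordN n \in C) (+) parityN t.
  move: t; apply: spanN_ind => [|g x gt IH] n nS.
    by rewrite N.lxor_0_r addbF.
  have [gS [pg wg]] : g \in stdN /\ parityN g /\ wtN g = 4%N.
    have : all (fun g => [&& g \in stdN, parityN g & wtN g == 4%N]) tetradsN.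
      by vm_compute.
    by move/allP/(_ _ gt)/and3P=> [-> -> /eqP].
  have gT : wordN g \in tetrads C.
    by apply/tetradP; rewrite hC mem_std // wt_wordN.
  rewrite -N.lxor_assoc IH ?stdN_lxor // wordN_lxor (tetrad_flip gC C0 gT); last first.
    by rewrite hC mem_std.
  by rewrite parityN_lxor pg; case: (_ \in C); case: parityN.
have memC n : n \in stdN -> (wordN n \in C) = ~~ outN (bitsN bs) n.
  move=> nS; have /and3P[lS pl dS] := allP stdN_split _ nS.
  have := flip _ dS _ lS.
  rewrite -N.lxor_assoc [N.lxor _ n]N.lxor_comm N.lxor_assoc.
  rewrite N.lxor_nilpotent N.lxor_0_r => ->.
  rewrite /outN bsE ?classN_classes // parityN_lxor (negbTE pl) addbF.
  by case: (_ \in C); case: parityN.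
apply/setP=> w; apply/idP/idP=> [wC|].
  have : w \in std by rewrite -hC (subsetP (sub_hull C)).
  by case/stdP=> n nS wE; rewrite wE in wC *; rewrite mem_stdcode // -memC.
by case/stdcodeP=> n [nS no ->]; rewrite memC.
Qed.

Lemma good_equiv_stdcode C : good C ->
  exists bs, code_equiv C (stdcode (bitsN bs)) /\ size bs = 16%N.
Proof.
move=> gC.
have [w wC] : exists w, w \in C.
  by apply/set0Pn; rewrite -card_gt0; case/and3P: gC => _ /eqP-> _.
pose tr := [ffun i => tperm 0 (w 0 i)] : {ffun 'I_20 -> {perm 'F_2}}.
pose C1 := [set word_map 1%g tr u | u in C].
have g1 : good C1 by apply: good_word_map.
have z1 : 0 \in C1.
  by apply/imsetP; exists w; rewrite // translate_word_map addWW.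
have [s tS] := tetrads_standard g1 z1.
pose C2 := [set pm s u | u in C1].
have g2 : good C2 by apply: good_pm.
have z2 : 0 \in C2 by apply/imsetP; exists 0; rewrite ?pm0.
have [s' bS] := basis_standard g2 z2 tS.
pose C3 := [set pm s' u | u in C2].
have g3 : good C3 by apply: good_pm.
have z3 : 0 \in C3 by apply/imsetP; exists 0; rewrite ?pm0.
have [bs [e sz]] := good_stdcode_hull g3 z3 (hull_std g3 z3 bS).
exists bs; split=> //; rewrite -e.
apply: code_equiv_trans (code_equiv_word_map 1%g tr C) _.
apply: code_equiv_trans (code_equiv_pm s C1) _.
exact: code_equiv_pm.
Qed.

(** A symmetry of the standard code: permute the coordinates along [l], then
    add [t].  On classes it acts as the table [c], and it changes the parity
    by the function with table [a]. *)
Notation move := (seq nat * N * seq N * N)%type.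

Definition Move l t c a : move := (l, t, c, a).
Definition mv_l (mv : move) : seq nat := mv.1.1.1.
Definition mv_t (mv : move) : N := mv.1.1.2.
Definition mv_c (mv : move) : seq N := mv.1.2.
Definition mv_a (mv : move) : N := mv.2.

(** The bit of [permN l n] at [j] is that of [n] at the [j]-th entry of [l]. *)
Definition permN (l : seq nat) n : N :=
  bitsN [seq N.testbit n (N.of_nat j) | j <- l].

Definition applyN (mv : move) n : N := N.lxor (permN (mv_l mv) n) (mv_t mv).

(** A standard word is recomputed from its coordinates; any fixed point is thus
    a standard word. *)
Definition retractN n : N :=
  let z := classN n in let b := N.testbit n in
  combN [:: N.testbit z 0; N.testbit z 1; N.testbit z 2; N.testbit z 3;
            b 0; b 4; b 8; b 12; b 16]%num basisN.

(** [mv] is a permutation of the coordinates with a translation, it preserves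
    the standard code, and its effect on classes and parities is as declared. *)
Definition move_ok (mv : move) : bool :=
  [&& size (mv_l mv) == 20, all (gtn 20) (mv_l mv), uniq (mv_l mv) &
    all (fun n => let n' := applyN mv n in
      [&& retractN n' == n',
          classN n' == nth 0%num (mv_c mv) (N.to_nat (classN n)) &
          parityN n' == parityN n (+) N.testbit (mv_a mv) (classN n)]) stdN]%N.

(** The table of the function whose code is mapped by [mv] to that of [f]. *)
Definition pullN (mv : move) f : N :=
  bitsN [seq N.testbit (mv_a mv) z (+) N.testbit f (nth 0%num (mv_c mv) (N.to_nat z))
        | z <- classes].

Lemma move_equiv mv f : move_ok mv ->
  code_equiv (stdcode (pullN mv f)) (stdcode f).
Proof.
case/and4P=> /eqP sz /allP lt ul /allP ok.
have lt' (j : 'I_20) : (nth 0%N (mv_l mv) j < 20)%N by apply: lt; rewrite mem_nth // sz.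
pose g j := Ordinal (lt' j).
have g_inj : injective g.
  move=> i j [] /eqP; rewrite nth_uniq ?sz // => /eqP; exact: val_inj.
pose s := perm g_inj; pose t := wordN (mv_t mv).
have act n : pm s (wordN n) + t = wordN (applyN mv n).
  rewrite /applyN wordN_lxor; congr (_ + _); apply/rowP=> j; rewrite !mxE permE.
  by rewrite /permN testbit_bitsN (nth_map 0%N) ?sz.
have okS n : n \in stdN -> applyN mv n \in stdN /\
    outN f (applyN mv n) = outN (pullN mv f) n.
  move=> nS; have /and3P[/eqP r /eqP c /eqP p] := ok _ nS.
  split; first by rewrite -r; apply: combN_span.
  by rewrite /outN testbit_table ?classN_classes // c p addbA.
pose tr := [ffun i => tperm 0 (t 0 i)] : {ffun 'I_20 -> {perm 'F_2}}.
suff e : [set pm s w + t | w in stdcode (pullN mv f)] = stdcode f.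
  apply: code_equiv_trans (code_equiv_pm s _) _.
  apply: code_equiv_trans (code_equiv_word_map 1%g tr _) _.
  rewrite -imset_comp (eq_imset (g := fun w => pm s w + t)) ?e.
    exact: code_equiv_refl.
  by move=> w; rewrite /= translate_word_map.
apply/eqP; rewrite eqEcard !card_imset ?card_stdcode //; last first.
  by move=> u v /addWI /pm_inj.
rewrite leqnn andbT; apply/subsetP=> _ /imsetP[_ /stdcodeP[n [nS no ->]] ->].
by have [aS o] := okS n nS; rewrite act mem_stdcode // o.
Qed.

(** Symmetries that fix all classes: the translation by a tetrad, and double
    transpositions inside blocks 0 and 1.  They change the parity by the
    constant function and by the four coordinate functions. *)
Definition affine_moves : seq move :=
  [:: Move (iota 0 20) 0xF classes 0xFFFF;
      Move ([:: 1; 0; 3; 2] ++ iota 4 16)%N 0 classes 0xAAAA;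
      Move ([:: 2; 3; 0; 1] ++ iota 4 16)%N 0 classes 0xCCCC;
      Move (iota 0 4 ++ [:: 5; 4; 7; 6] ++ iota 8 12)%N 0 classes 0xF0F0;
      Move (iota 0 4 ++ [:: 6; 7; 4; 5] ++ iota 8 12)%N 0 classes 0xFF00]%num.

(** A basis of the affine functions of the class. *)
Definition affineN : seq N := [seq mv_a mv | mv <- affine_moves].

Lemma affine_moves_ok : all move_ok affine_moves.
Proof. by vm_compute. Qed.

Lemma eq_stdcode f g : {in classes, N.testbit f =1 N.testbit g} ->
  stdcode f = stdcode g.
Proof.
move=> fg; apply/setP=> w; apply/stdcodeP/stdcodeP=> -[n [nS no ->]];
  exists n; split=> //; move: no; rewrite /outN fg //; exact: classN_classes.
Qed.

Lemma affine_equiv f a : a \in spanN affineN ->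
  code_equiv (stdcode (N.lxor f a)) (stdcode f).
Proof.
move=> aS; move: a aS f; apply: spanN_ind => [|g x gA IH] f.
  by rewrite N.lxor_0_r code_equiv_refl.
rewrite -N.lxor_assoc; apply: code_equiv_trans (IH _) _.
case/mapP: gA => mv mvA ->.
have -> : stdcode (N.lxor f (mv_a mv)) = stdcode (pullN mv f).
  apply: eq_stdcode => z zc; rewrite testbit_table // testbit_lxor addbC.
  congr (_ (+) N.testbit f _).
  have : all (fun mv => all (fun z => z == nth 0%num (mv_c mv) (N.to_nat z)) classes)
    affine_moves by vm_compute.
  by move/allP/(_ _ mvA)/allP/(_ _ zc)/eqP.
by apply: move_equiv; apply: (allP affine_moves_ok).
Qed.

(** The affine function that agrees with [f] at [0] and at the four basis
    classes, and the difference of [f] and this function. *)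
Definition affine_part f : N :=
  let b := N.testbit f in
  combN [:: b 0; b 0 (+) b 1; b 0 (+) b 2; b 0 (+) b 4; b 0 (+) b 8]%num affineN.

Definition normN f : N := N.lxor f (affine_part f).

Lemma norm_equiv f : code_equiv (stdcode (normN f)) (stdcode f).
Proof. by apply: affine_equiv; apply: combN_span. Qed.

(** Powers of [2] at the classes other than [0] and the four basis classes. *)
Definition freeN : seq N :=
  [:: 0x8; 0x20; 0x40; 0x80; 0x200; 0x400; 0x800; 0x1000; 0x2000; 0x4000; 0x8000]%num.

(** A normalized function vanishes at [0] and at the four basis classes. *)
Lemma norm_free bs : size bs = 16%N -> normN (bitsN bs) \in spanN freeN.
Proof.
move=> sz; set f := bitsN bs; set b := N.testbit (normN f).
suff -> : normN f = combN [:: b 3; b 5; b 6; b 7; b 9; b 10; b 11; b 12; b 13;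
    b 14; b 15]%num freeN.
  exact: combN_span.
have testbit_if (c : bool) x i :
    N.testbit (if c then x else 0%num) i = c && N.testbit x i.
  by case: c => //; rewrite N.bits_0.
apply: bitsN_inj => i; have [i16|i16] := ltnP i 16; last first.
  pose xs := [:: 0; 0xFFFF; 0xAAAA; 0xCCCC; 0xF0F0; 0xFF00]%num ++ freeN.
  have hi x : x \in xs -> N.testbit x (N.of_nat i) = false.
    move=> xS; have : all (fun x => (N.log2 x <? 16)%num) xs by vm_compute.
    move/allP/(_ _ xS)/N.ltb_lt => lx; apply: N.bits_above_log2.
    by apply: (N.lt_le_trans _ 16) => //; lia.
  rewrite /normN /affine_part /combN /= !testbit_lxor !testbit_if testbit_bitsN.
  by rewrite nth_default ?sz // !hi // !andbF.
have b0 : all (fun z => ~~ b z) [:: 0; 1; 2; 4; 8]%num.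
  rewrite /= /b /normN /affine_part /combN /= !testbit_lxor !testbit_if /=.
  by case: (N.testbit f 0); case: (N.testbit f 1); case: (N.testbit f 2);
     case: (N.testbit f 4); case: (N.testbit f 8).
rewrite -/b; move: b b0 => b /= /and5P[b_0 b_1 b_2 b_4 /andP[b_8 _]].
rewrite /combN /= !testbit_lxor !testbit_if.
do 16?[case: i i16 => [|i] i16; first by
  rewrite /= ?andbT ?andbF ?addbF //; apply/negbTE].
by [].
Qed.

(** Symmetries acting on the classes [(x, y)] as a translation by [(1, 0)],
    and as the maps to [(y, x)], [(x + y, y)] and [(x, w y)], which generate
    the general linear group over the field with four elements. *)
Definition quotient_moves : seq move :=
  [:: Move (iota 0 20) 0xAAA0A
        [:: 1; 0; 3; 2; 5; 4; 7; 6; 9; 8; 11; 10; 13; 12; 15; 14] 0;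
      Move (iota 4 4 ++ iota 0 4 ++ iota 8 4 ++ [:: 16; 18; 19; 17; 12; 15; 13; 14])%N 0
        [:: 0; 4; 8; 12; 1; 5; 9; 13; 2; 6; 10; 14; 3; 7; 11; 15] 0;
      Move (iota 8 4 ++ iota 4 4 ++ iota 0 4 ++ iota 16 4 ++ iota 12 4)%N 0
        [:: 0; 1; 2; 3; 5; 4; 7; 6; 10; 11; 8; 9; 15; 14; 13; 12] 0;
      Move (iota 0 4 ++ [:: 4; 6; 7; 5] ++ iota 12 8 ++ iota 8 4)%N 0
        [:: 0; 1; 2; 3; 8; 9; 10; 11; 12; 13; 14; 15; 4; 5; 6; 7] 0]%num.

Lemma quotient_moves_ok : all move_ok quotient_moves.
Proof. by vm_compute. Qed.

(** Representatives of the orbits of boolean functions of the class, up to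
    affine functions. *)
Definition reps : seq N :=
  [:: 0x0; 0x8; 0x28; 0x68; 0xe0; 0xe8; 0x2a8; 0x2e8; 0x4e8; 0x660; 0x6a8;
      0x1248; 0x18e8; 0x24e8; 0x6ca0]%num.

(** Tables of functions whose code is equivalent to a representative. *)
Definition reached f := exists2 r, r \in reps & code_equiv (stdcode f) (stdcode r).

Definition neighbours f : seq N := [seq normN (pullN mv f) | mv <- quotient_moves].

Lemma reached_neighbours f : reached f -> {in neighbours f, forall g, reached g}.
Proof.
case=> r rR fr _ /mapP[mv mvQ ->]; exists r => //.
apply: code_equiv_trans (norm_equiv _) _.
by apply: code_equiv_trans fr; apply: move_equiv; apply: (allP quotient_moves_ok).
Qed.

(** Depth-first search along [neighbours].  A table [f] is stored in [seen] as
    the positive number [f + 1]. *)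
Fixpoint search (fuel : nat) (todo : seq N) (seen : PositiveSet.t) : PositiveSet.t :=
  if fuel is k.+1 then
    if todo is f :: todo' then
      if PositiveSet.mem (N.succ_pos f) seen then search k todo' seen
      else search k (neighbours f ++ todo') (PositiveSet.add (N.succ_pos f) seen)
    else seen
  else seen.

Lemma search_sound fuel todo seen :
  {in todo, forall f, reached f} ->
  (forall f, PositiveSet.mem (N.succ_pos f) seen -> reached f) ->
  forall f, PositiveSet.mem (N.succ_pos f) (search fuel todo seen) -> reached f.
Proof.
elim: fuel todo seen => [|k IH] [|f todo] seen ht hs //.
rewrite [search _ _ _](_ : _ = if PositiveSet.mem (N.succ_pos f) seen
  then search k todo seen
  else search k (neighbours f ++ todo) (PositiveSet.add (N.succ_pos f) seen)) //.
have hf : reached f by apply: ht; rewrite mem_head.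
have ht' : {in todo, forall f, reached f}.
  by move=> g gt; apply: ht; rewrite inE gt orbT.
case: ifP => _; apply: IH => //.
  by move=> g; rewrite mem_cat => /orP[|/ht'//]; apply: reached_neighbours.
move=> g /PositiveSet.mem_spec/PositiveSet.add_spec [e|]; last first.
  by move/PositiveSet.mem_spec/hs.
suff -> : g = f by [].
by apply: N.succ_inj; rewrite -!N.succ_pos_spec e.
Qed.

(** At most 2048 tables have their four neighbours pushed, so [2 ^ 14] steps
    are enough to empty the stack. *)
Lemma search_full :
  let seen := search (2 ^ 14) reps PositiveSet.empty in
  all (fun f => PositiveSet.mem (N.succ_pos f) seen) (spanN freeN).
Proof. by vm_compute. Qed.

Lemma free_reached : {in spanN freeN, forall f, reached f}.
Proof.
move=> f /(allP search_full); apply: search_sound => [g gR|g].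
  by exists g => //; apply: code_equiv_refl.
by rewrite PositiveSet.mem_Leaf.
Qed.

Lemma good_reached C : good C -> exists2 r, r \in reps & code_equiv C (stdcode r).
Proof.
move=> /good_equiv_stdcode[bs [e sz]].
have [r rR h] := free_reached (norm_free sz); exists r => //.
apply: code_equiv_trans e _; apply: code_equiv_trans h.
by apply: code_equiv_sym; apply: norm_equiv.
Qed.

End Reduction.

(** * An invariant that separates the representatives *)

Section Invariant.

Local Open Scope ring_scope.

Notation W := 'rV['F_2]_20.

Implicit Types (C : {set W}) (x y w s : W) (n m f z : N).

(** The union of [C] and its translate by the all-one word.  For the subcodes
    [stdcode f] it is the standard code; unlike [hull C], it is mapped to its
    analogue by every equivalence, also if it moves the zero word. *)
Definition hull1 C : {set W} := C :|: [set x + allone 20 | x in C].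

(** Collinearity of the classes of [x], [y] and [w], expressed with distances:
    the word [s] differs from [x] by a tetrad, and the distances from [y] and
    from [w] change when [x] is replaced by [s] exactly if [y] and [w] agree
    with [x], modulo the tetrad, on its block. *)
Definition collinear C x y w : bool :=
  [exists s in hull1 C, [&& hamming_dist x s == 4%N,
     hamming_dist y s != hamming_dist y x & hamming_dist w s != hamming_dist w x]].

Definition odd_triple C x y w : bool :=
  (x \in C) (+) (y \in C) (+) (w \in C) (+) (x + y + w \in C).

(** The number of triples that have an odd number of members in [C] among
    [x], [y], [w] and [x + y + w]; if [coll] holds, only the collinear ones. *)
Definition triple_count (coll : bool) C : nat :=
  \sum_(x in hull1 C) \sum_(y in hull1 C) \sum_(w in hull1 C)
    (odd_triple C x y w && (coll ==> collinear C x y w)).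

Lemma triple_count_equiv coll C C' : code_equiv C C' ->
  triple_count coll C = triple_count coll C'.
Proof.
case/code_equivP=> s [p ->]; set F := word_map s p.
have F_inj : injective F := @word_map_inj _ s p.
have inF x A : (F x \in [set F u | u in A]) = (x \in A).
  by apply/imsetP/idP=> [[y yA /F_inj->//]|xA]; exists x.
have hF : hull1 [set F u | u in C] = [set F u | u in hull1 C].
  rewrite /hull1 imsetU; congr (_ :|: _); rewrite -!imset_comp.
  by apply: eq_imset => u; rewrite /= /F word_map_allone.
rewrite /triple_count hF big_imset; last by move=> ? ? _ _; apply: F_inj.
apply: eq_bigr => x xD; rewrite big_imset; last by move=> ? ? _ _; apply: F_inj.
apply: eq_bigr => y yD; rewrite big_imset; last by move=> ? ? _ _; apply: F_inj.
apply: eq_bigr => w wD; congr (nat_of_bool (_ && (_ ==> _))).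
  by rewrite /odd_triple -/F -!word_map3 !inF.
apply/exists_inP/exists_inP=> [[t tD] h|[t]].
  by exists (F t); rewrite ?hF ?inF // !dist_word_map.
by rewrite hF => /imsetP[t' tD' ->]; rewrite !dist_word_map => ?; exists t'.
Qed.

(** For each block, the four classes that vanish on it: these are the five
    lines through the origin of the affine plane over the field with four
    elements. *)
Definition linesN : seq (seq N) :=
  [:: [:: 0; 4; 8; 12]; [:: 0; 1; 2; 3]; [:: 0; 5; 10; 15];
      [:: 0; 6; 11; 13]; [:: 0; 7; 9; 14]]%num.

(** The classes [0], [a] and [b] are collinear. *)
Definition collinearN a b : bool := has (fun l => (a \in l) && (b \in l)) linesN.

Lemma hull1_stdcode f : hull1 (stdcode f) = std.
Proof.
have one : wordN 0xFFFFF = allone 20.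
  apply/rowP=> j; rewrite !mxE; case: j => j.
    by do 20?[case: j => [|j] //]; move=> ?; apply: val_inj.
have oneS : 0xFFFFF%num \in stdN by vm_compute.
have flip n : outN f (N.lxor n 0xFFFFF) = ~~ outN f n.
  by rewrite /outN parityN_lxor classN_lxor N.lxor_0_r addbT addNb.
apply/setP=> w; apply/setUP/stdP=> [[/stdcodeP[n [nS no ->]]|]|[n nS ->]].
- by exists n.
- case/imsetP=> _ /stdcodeP[n [nS no ->]] ->.
  by exists (N.lxor n 0xFFFFF); rewrite ?stdN_lxor // wordN_lxor one.
have [no|no] := boolP (outN f n); last by left; rewrite mem_stdcode.
right; apply/imsetP; exists (wordN (N.lxor n 0xFFFFF)).
  by rewrite mem_stdcode ?stdN_lxor // flip no.
by rewrite wordN_lxor one addWK.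
Qed.

(** The weight of a standard word changes by the addition of a tetrad exactly
    if the word vanishes on its block modulo the tetrad. *)
Lemma stdN_lines : all (fun n => all (fun tl =>
  (wtN (N.lxor n tl.1) != wtN n) == (classN n \in tl.2)) (zip tetradsN linesN)) stdN.
Proof. by vm_compute. Qed.

Lemma collinear_std f : {in stdN & &, forall n m k,
  collinear (stdcode f) (wordN n) (wordN m) (wordN k)
   = collinearN (N.lxor (classN m) (classN n)) (N.lxor (classN k) (classN n))}.
Proof.
move=> n m k nS mS kS.
have dst a b : hamming_dist (wordN a) (wordN b) = wtN (N.lxor a b).
  by rewrite hamming_distE -wordN_lxor wt_wordN.
have lin a tl : a \in stdN -> tl \in zip tetradsN linesN ->
    (wtN (N.lxor a tl.1) != wtN a) = (classN a \in tl.2).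
  by move=> aS tlS; have /allP/(_ _ tlS)/eqP := allP stdN_lines _ aS.
have sh a t : N.lxor a (N.lxor n t) = N.lxor (N.lxor a n) t by rewrite N.lxor_assoc.
rewrite -!classN_lxor; apply/exists_inP/hasP => [[w]|[l lL]].
  rewrite hull1_stdcode => /stdP[s sS ->]; rewrite !dst => /and3P[/eqP w4].
  have [t tE sE] : exists2 t, t = N.lxor n s & s = N.lxor n t.
    by exists (N.lxor n s); rewrite // -N.lxor_assoc N.lxor_nilpotent N.lxor_0_l.
  have tT : t \in tetradsN.
    rewrite tE; have /andP[_] := allP stdN_weights _ (stdN_lxor nS sS).
    rewrite w4 /= => /orP[/eqP e|//]; by rewrite e in w4.
  rewrite {}sE !sh => h1 h2; pose i := index t tetradsN.
  have i5 : (i < 5)%N by rewrite -[5%N]/(size tetradsN) index_mem.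
  have tlS : (t, nth [::] linesN i) \in zip tetradsN linesN.
    by rewrite -(nth_index 0%num tT) -/i -nth_zip // mem_nth.
  exists (nth [::] linesN i); first by rewrite mem_nth.
  by rewrite -!(lin _ _ _ tlS) ?stdN_lxor //; apply/andP.
move=> /andP[ml kl]; pose i := index l linesN.
have i5 : (i < 5)%N by rewrite -[5%N]/(size linesN) index_mem.
pose t := nth 0%num tetradsN i.
have tlS : (t, l) \in zip tetradsN linesN.
  by rewrite /t -[X in (_, X)](nth_index [::] lL) -/i -nth_zip // mem_nth.
have tT : t \in tetradsN by rewrite mem_nth.
have tS : t \in stdN.
  by apply: (allP (_ : all (mem stdN) tetradsN)) tT; vm_compute.
exists (wordN (N.lxor n t)); first by rewrite hull1_stdcode mem_std ?stdN_lxor.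
rewrite !dst !sh N.lxor_nilpotent N.lxor_0_l.
rewrite !(lin _ _ _ tlS) ?stdN_lxor // ml kl !andbT.
by apply: (allP (_ : all (fun t => wtN t == 4%N) tetradsN)) tT; vm_compute.
Qed.

(** The values of [f] at [a], [b], [c] and their sum add up to [1]. *)
Definition oddN f a b c : bool :=
  let g := N.testbit f in g a (+) g b (+) g c (+) g (N.lxor (N.lxor a b) c).

Lemma odd_std f : {in stdN & &, forall n m k,
  odd_triple (stdcode f) (wordN n) (wordN m) (wordN k)
   = oddN f (classN n) (classN m) (classN k)}.
Proof.
move=> n m k nS mS kS; rewrite /odd_triple -!wordN_lxor !mem_stdcode ?stdN_lxor //.
rewrite /outN /oddN !parityN_lxor !classN_lxor.
case: (parityN n); case: (parityN m); case: (parityN k);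
  by do 4!case: (N.testbit f _).
Qed.

(** A sum over the standard code of a function of the class. *)
Lemma sum_std (h : W -> nat) (H : N -> nat) :
  {in stdN, forall n, h (wordN n) = H (classN n)} ->
  (\sum_(x in std) h x = 32 * \sum_(z <- classes) H z)%N.
Proof.
move=> hH; rewrite (eq_bigl (fun x => x \in [seq wordN n | n <- stdN])); last first.
  by move=> x; rewrite inE.
rewrite -(big_uniq _ uniq_stdW) big_map big_seq (eq_bigr _ hH) -big_seq.
rewrite -(big_map classN xpredT H).
have : perm_eq [seq classN n | n <- stdN] (flatten (nseq 32 classes)) by vm_compute.
move/(perm_big _)=> ->.
by rewrite big_flatten big_nseq -/(iter_addn_0 _ _) iter_addn_0 mulnC.
Qed.

(** The analogue of [triple_count] for classes in place of words. *)
Definition triple_countN (coll : bool) f : nat :=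
  (\sum_(a <- classes) \sum_(b <- classes) \sum_(c <- classes)
    (oddN f a b c && (coll ==> collinearN (N.lxor b a) (N.lxor c a))))%N.

Lemma triple_count_std coll f :
  triple_count coll (stdcode f) = (32 * (32 * (32 * triple_countN coll f)))%N.
Proof.
rewrite /triple_count hull1_stdcode /triple_countN.
rewrite (sum_std (H := fun a => 32 * (32 * \sum_(b <- classes) \sum_(c <- classes)
    (oddN f a b c && (coll ==> collinearN (N.lxor b a) (N.lxor c a)))))%N).
  by rewrite -!big_distrr.
move=> n nS.
rewrite (sum_std (H := fun b => 32 * \sum_(c <- classes)
    (oddN f (classN n) b c && (coll ==>
       collinearN (N.lxor b (classN n)) (N.lxor c (classN n)))))%N).
  by rewrite -big_distrr.
move=> m mS; apply: sum_std => k kS.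
by rewrite odd_std // collinear_std.
Qed.

(** An unlocked form, for evaluation. *)
Lemma triple_countNE coll f : triple_countN coll f =
  foldr (fun a i => foldr (fun b j => foldr (fun c k =>
    (oddN f a b c && (coll ==> collinearN (N.lxor b a) (N.lxor c a))) + k)
    0 classes + j) 0 classes + i)%N 0%N classes.
Proof. by rewrite /triple_countN unlock. Qed.

Lemma triple_counts_uniq :
  uniq [seq (triple_countN true r, triple_countN false r) | r <- reps].
Proof.
under eq_map => r do rewrite !triple_countNE.
by vm_compute.
Qed.

Lemma reps_inequiv : {in reps &, forall r r',
  code_equiv (stdcode r) (stdcode r') -> r = r'}.
Proof.
move=> r r' rR rR' e.
have c b : triple_countN b r = triple_countN b r'.
  have /eqP := triple_count_equiv b e; rewrite !triple_count_std.
  by rewrite !eqn_pmul2l // => /eqP.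
rewrite -(nth_index 0%num rR) -(nth_index 0%num rR'); congr nth; apply/eqP.
rewrite -(nth_uniq (0, 0)%N _ _ triple_counts_uniq) ?size_map ?index_mem //.
by rewrite !(nth_map 0%num) ?index_mem // !nth_index // !c.
Qed.

End Invariant.

(** * The classification *)

Theorem proposition5p4 :
  #|equivalence_partition (@code_equiv 20)
      [set C : {set 'rV['F_2]_20} |
         [&& is_code 8 C, #|C| == 256 & dists_divisible 4 C]]| = 15.
Proof.
set A := [set C | _].
pose cl r := [set C in A | code_equiv (stdcode r) C].
have -> : equivalence_partition (@code_equiv 20) A =
    [set X in [seq cl r | r <- reps]].
  apply/setP=> X; rewrite [RHS]inE; apply/imsetP/mapP=> [[C]|[r rR ->]].
    rewrite inE => /good_reached[r rR e] ->; exists r => //.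
    apply/setP=> D; rewrite !inE; congr (_ && _).
    apply/idP/idP; apply: code_equiv_trans => //; exact: code_equiv_sym.
  by exists (stdcode r); rewrite // inE; apply: good_stdcode.
rewrite cardsE (card_uniqP _) ?size_map //.
rewrite map_inj_in_uniq // => r r' rR rR' /setP/(_ (stdcode r')).
have gA f : stdcode f \in A by rewrite inE; apply: good_stdcode.
rewrite [LHS]in_set [RHS]in_set !gA code_equiv_refl /=.
exact: reps_inequiv.
Qed.
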